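(* Let $\kappa\in\mathbb R$, $\lambda>0$ and $S=YG$ with $G\sim N(0,1)$ and $Y\mid G\sim\mathrm{Rad}(\varphi(\sqrt\lambda G))$. There exists $\alpha_0=\alpha_0(\lambda,\kappa_+)>0$ such that for all $0<\alpha<\alpha_0$ the saddle point problem $\sup_{x\in(-1,1)}\inf_{q\in[0,1)}\Phi(x,q)$ is uniquely achieved, at a pair $(x_\star,q_\star)$ which solves the system of equations $$\frac{x}{\sqrt{1-x^2}}=\alpha\sqrt{\lambda(1-q)}\;\mathbb E\Big[\varphi(-\sqrt\lambda S)\,\mathcal A\Big(\frac{\kappa-xS-\sqrt{(1-x^2)q}\,Z}{\sqrt{(1-x^2)(1-q)}}\Big)\Big],$$ $$\frac q{1-q}=\alpha\;\mathbb E\Big[\mathcal A\Big(\frac{\kappa-xS-\sqrt{(1-x^2)q}\,Z}{\sqrt{(1-x^2)(1-q)}}\Big)^2\Big],$$ where $Z\sim N(0,1)$ is independent of $(G,Y)$.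
   Context: $\kappa_+=\max\{\kappa,0\}$. $\varphi(x)=1/(1+e^{-x})$; $\mathrm{Rad}(p)$ is the law on $\{-1,+1\}$ giving mass $p$ to $+1$. $\mathcal N(x)=\int_x^\infty e^{-z^2/2}dz/\sqrt{2\pi}$ and $\mathcal A(x)=-\mathcal N'(x)/\mathcal N(x)=\frac1{\sqrt{2\pi}}e^{-x^2/2}/\mathcal N(x)$. For $(x,q)\in(-1,1)\times[0,1)$ and $Z\sim N(0,1)$ independent of $S$, $$\Phi(x,q)=\alpha\,\mathbb E\log\mathcal N\Big(\frac{\kappa-xS-\sqrt{(1-x^2)q}\,Z}{\sqrt{(1-x^2)(1-q)}}\Big)+\frac12\frac q{1-q}+\frac12\log\big((1-x^2)(1-q)\big).$$ The saddle point problem is said to be uniquely achieved at $(x_\star,q_\star)$ if there is a unique $x_\star\in[0,1)$ achieving $\sup_{x\in(-1,1)}\inf_{q\in[0,1)}\Phi(x,q)$, and a unique $q_\star\in[0,1)$ achieving $\inf_{q\in[0,1)}\Phi(x_\star,q)$. *)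

(* Defs.v *)
From HB Require Import structures.
From mathcomp Require Import all_boot all_order all_algebra.
From mathcomp Require Import all_classical all_reals all_analysis.

Set Implicit Arguments.
Unset Strict Implicit.
Unset Printing Implicit Defensive.

Import Order.TTheory GRing.Theory Num.Theory.
Import numFieldNormedType.Exports.

Local Open Scope classical_set_scope.
Local Open Scope ring_scope.

Section special_functions.
Context {R : realType}.
Implicit Types x z : R.

Definition logistic x : R := (1 + expR (- x))^-1.

Definition gauss_density z : R := expR (- (z ^+ 2 / 2)) / Num.sqrt (2 * pi).

Definition gauss_tail x : R :=
  \int[lebesgue_measure]_(z in `[x, +oo[) gauss_density z.

Definition inv_mills x : R := - derive1 gauss_tail x / gauss_tail x.

Lemma gauss_densityE : gauss_density = normal_pdf 0 1.
Proof.
apply/funext => z; rewrite normal_pdfE ?oner_neq0// /gauss_density.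
rewrite /normal_peak /normal_fun subr0 expr1n mul1r mulNr mulrC.
by rewrite -[pi *+ 2]mulr_natl.
Qed.

Lemma inv_millsE x : inv_mills x = gauss_density x / gauss_tail x.
Proof.
rewrite /inv_mills; congr (_ / _).
have intT : (@lebesgue_measure R).-integrable setT (EFin \o gauss_density).
  by rewrite gauss_densityE; exact: integrable_normal_pdf.
pose F y := \int[lebesgue_measure]_(z in `]-oo, y]) gauss_density z.
have FE : gauss_tail = (cst 1 - F : R -> R).
  apply/funext => y; apply/eqP; rewrite [X in _ == X]/= eq_sym subr_eq; apply/eqP.
  rewrite /F /gauss_tail -(@Rintegral_itv_bndo_bndc _ -oo%O y); last first.
    exact: integrableS intT.
  rewrite addrC -Rintegral_setU//=.
  - rewrite -itv_bndbnd_setU//= set_itvNyy /Rintegral gauss_densityE.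
    by rewrite integral_normal_pdf.
  - by apply: integrableS intT => //; exact: measurableU.
  - apply/disj_set2P; rewrite -subset0 => z [] /=.
    by rewrite !in_itv/= andbT => zy /(lt_le_trans zy); rewrite ltxx.
have [dF FxE] : derivable F x 1 /\ derive1 F x = gauss_density x.
  apply: (@continuous_FTC1 _ _ -oo%O x (x + 1)) => //; rewrite ?ltrDl//.
    exact: integrableS intT.
    by rewrite ltNyr.
  by rewrite gauss_densityE; apply: continuous_normal_pdf; rewrite oner_neq0.
rewrite FE derive1E deriveB//= derive_cst sub0r opprK -derive1E.
exact: FxE.
Qed.

End special_functions.

(* The law on {-1, 1} with mass p at 1; meaningful only for 0 <= p <= 1. *)
Definition rademacher_prob {R : realType} (p : R) : set R -> \bar R :=
  pushforward (bernoulli_prob p) (fun b : bool => if b then 1 else - 1 : R).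

Definition has_law d d' (T : measurableType d) (U : measurableType d')
    (R : realType) (P : probability T R) (X : T -> U) (mu : set U -> \bar R) :=
  forall A : set U, measurable A -> P (X @^-1` A) = mu A.

(* Y | X ~ K(X): the disintegration identity characterizing K as a version of
   the conditional law of Y given X. *)
Definition has_cond_law d d1 d2 (T : measurableType d) (U : measurableType d1)
    (V : measurableType d2) (R : realType) (P : probability T R)
    (Y : T -> V) (X : T -> U) (K : U -> set V -> \bar R) :=
  forall (A : set U) (B : set V), measurable A -> measurable B ->
    P (X @^-1` A `&` Y @^-1` B) = (\int[P]_(w in X @^-1` A) K (X w) B)%E.

Definition independent_RVs d d1 d2 (T : measurableType d)
    (U : measurableType d1) (V : measurableType d2) (R : realType)
    (P : probability T R) (X : T -> U) (Y : T -> V) :=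
  forall (A : set U) (B : set V), measurable A -> measurable B ->
    P (X @^-1` A `&` Y @^-1` B) = (P (X @^-1` A) * P (Y @^-1` B))%E.

Section saddle_point.
Context d (T : measurableType d) (R : realType) (P : probability T R).
Implicit Types (kappa alpha lambda x q : R) (S Z : T -> R).

Definition margin kappa S Z x q (w : T) : R :=
  (kappa - x * S w - Num.sqrt ((1 - x ^+ 2) * q) * Z w)
    / Num.sqrt ((1 - x ^+ 2) * (1 - q)).

Definition Phi alpha kappa S Z x q : \bar R :=
  (alpha%:E * 'E_P[fun w => ln (gauss_tail (margin kappa S Z x q w))]
   + (2^-1 * (q / (1 - q)))%:E
   + (2^-1 * ln ((1 - x ^+ 2) * (1 - q)))%:E)%E.

Definition solves_saddle_system alpha kappa lambda S Z x q :=
  (x / Num.sqrt (1 - x ^+ 2))%:E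
    = ((alpha * Num.sqrt (lambda * (1 - q)))%:E
       * 'E_P[fun w => (logistic (- (Num.sqrt lambda * S w))
                        * inv_mills (margin kappa S Z x q w))%R])%E
  /\ (q / (1 - q))%:E
    = (alpha%:E * 'E_P[fun w => (inv_mills (margin kappa S Z x q w) ^+ 2)%R])%E.

End saddle_point.

(* Suprema and infima are taken in the extended reals, since inf_q may be -oo. *)
Definition inf_q (R : realType) (F : R -> R -> \bar R) (x : R) : \bar R :=
  ereal_inf [set F x q | q in `[0, 1[].

Definition sup_inf (R : realType) (F : R -> R -> \bar R) : \bar R :=
  ereal_sup [set inf_q F x | x in `]-1, 1[].

Definition uniquely_achieved_at (R : realType) (F : R -> R -> \bar R)
    (xs qs : R) :=
  unique (fun x : R => 0 <= x < 1 /\ inf_q F x = sup_inf F) xs /\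
  unique (fun q : R => 0 <= q < 1 /\ F xs q = inf_q F xs) qs.

(* Main.v *)
(* Put x = a / sqrt (1 + a^2) and q = b^2 / (1 + b^2). In these coordinates the
   margin is u = (kappa sqrt (1 + a^2) - a S) sqrt (1 + b^2) - b Z, and Phi is
     alpha g(a, b) + (b^2 - ln (1 + b^2)) / 2 - ln (1 + a^2) / 2,
   where g = E ln N(u). As S has density 2 logistic(sqrt lambda s) times the
   Gaussian one, integration by parts in S and in Z gives
     g_b = - b / (1 + b^2) E A(u)^2,
     g_a = (sqrt (1 + b^2) sqrt lambda E[logistic(- sqrt lambda S) A(u)]
            - a E A(u)^2) / (1 + a^2),
   so that, with |.| the L^2 norm, the critical points are the solutions of
     b = sqrt alpha |A(u)|,
     a = alpha sqrt lambda E[logistic(- sqrt lambda S) A(u)] / sqrt (1 + b^2).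
   The derivative of A is bounded and A'(u) u is bounded for u <= 0, hence on
   |a| <= 1, 0 <= b <= 1 both right-hand sides are Lipschitz with constants that
   depend only on lambda and kappa_+; for small alpha the system is a contraction
   and has at most one solution. Lower bounds on g of the form - C (1 + b^2) keep
   the minimizers in b below 1 and the maximizers in a inside ]-1, 1[, where
   compactness provides them, and Danskin's argument shows that the partial
   derivative in a vanishes at a maximizer. *)
Require Import Defs.
From mathcomp Require Import all_boot all_order all_algebra.
From mathcomp Require Import all_classical all_reals all_analysis.
From mathcomp Require Import measurable_realfun ring lra.

Set Implicit Arguments.
Unset Strict Implicit.
Unset Printing Implicit Defensive.

Import Order.TTheory GRing.Theory Num.Theory.
Import numFieldNormedType.Exports.

Local Open Scope classical_set_scope.
Local Open Scope ring_scope.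

(** The Lipschitz bounds hold only on the rectangle, while sup and inf run over unbounded ranges, so
    everything outside must be discarded by comparing values. For b >= 1 the growth of b^2 - ln (1 +
    b^2) beats the lower bound on g. For |a| >= 1 the single test point b = 0 suffices: there g <= 0
    gives a value at most - 1/4, whereas at a = 0 every value is at least - 1/32. The slope in b
    carries a factor b, so b = 0 is always critical; it has to be excluded as a minimizer before the
    fixed point equation can be read off. The threshold sees kappa only through kappa_+ because
    A(u), A'(u) |u| and - ln N(u) are all controlled by the positive part of u: on the negative side
    the Gaussian density decays faster than any power of u grows. Integrability and differentiation
    under the integral use |kappa| freely, but none of those constants enters alpha_0. Likewise the
    moment constants are chosen before the probability space and before lambda. *)

(** * Calculus on the real line *)

(* The derivation rules of the library concern [f + g], [f * g] and so on as
   functions; the pointwise forms below compose as proof terms. *)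
Section derivation_rules.
Context {R : realType}.
Implicit Types (f g : R -> R) (x y a b c : R).

Lemma is_derive_add f g x a b : is_derive x 1 f a -> is_derive x 1 g b ->
  is_derive x 1 (fun y => f y + g y) (a + b).
Proof. exact: is_deriveD. Qed.

Lemma is_derive_sub f g x a b : is_derive x 1 f a -> is_derive x 1 g b ->
  is_derive x 1 (fun y => f y - g y) (a - b).
Proof. exact: is_deriveB. Qed.

Lemma is_derive_mul f g x a b : is_derive x 1 f a -> is_derive x 1 g b ->
  is_derive x 1 (fun y => f y * g y) (f x * b + g x * a).
Proof. exact: is_deriveM. Qed.

Lemma is_derive_scale c f x a : is_derive x 1 f a ->
  is_derive x 1 (fun y => c * f y) (c * a).
Proof. exact: is_deriveZ. Qed.

Lemma is_derive_inv f x a : is_derive x 1 f a -> f x != 0 ->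
  is_derive x 1 (fun y => (f y)^-1) (- (f x) ^- 2 * a).
Proof. by move=> fa fx0; apply: is_deriveV. Qed.

Lemma is_derive_comp f g x a b : is_derive x 1 g b -> is_derive (g x) 1 f a ->
  is_derive x 1 (fun y => f (g y)) (a * b).
Proof. by move=> gb fa; apply: is_derive1_comp. Qed.

Lemma is_derive_expn f n x a : is_derive x 1 f a ->
  is_derive x 1 (fun y => f y ^+ n) (n%:R * f x ^+ n.-1 * a).
Proof.
move=> fa; have -> : (fun y => f y ^+ n) = f ^+ n.
  by apply/funext => y; rewrite exprfctE.
exact: is_deriveX.
Qed.

Lemma is_derive_const c x : is_derive x 1 (fun=> c : R) 0.
Proof. exact: is_derive_cst. Qed.

Lemma is_derive_var x : is_derive x 1 (fun y : R => y) 1.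
Proof. exact: is_derive_id. Qed.

Lemma is_derive_1Dsqr x : is_derive x 1 (fun y => 1 + y ^+ 2) (2 * x).
Proof.
apply: (is_derive_eq (is_derive_add (is_derive_const 1 x)
  (is_derive_expn 2 (is_derive_var x)))).
by rewrite add0r expr1 mulr1.
Qed.

Lemma is_derive_sqrt1Dsqr x :
  is_derive x 1 (fun y => Num.sqrt (1 + y ^+ 2)) (x / Num.sqrt (1 + x ^+ 2)).
Proof.
have x0 : 0 < 1 + x ^+ 2 by rewrite ltr_pwDl// sqr_ge0.
apply: (is_derive_eq (is_derive_comp (is_derive_1Dsqr x) (is_derive1_sqrt x0))).
have s0 : Num.sqrt (1 + x ^+ 2) != 0 by rewrite gt_eqF// sqrtr_gt0.
by field.
Qed.

Lemma is_derive_ln1Dsqr x :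
  is_derive x 1 (fun y => ln (1 + y ^+ 2)) (2 * x / (1 + x ^+ 2)).
Proof.
have x0 : 0 < 1 + x ^+ 2 by rewrite ltr_pwDl// sqr_ge0.
apply: (is_derive_eq (is_derive_comp (is_derive_1Dsqr x) (is_derive1_ln x0))).
by field; rewrite gt_eqF.
Qed.

Lemma is_derive_continuous f x a : is_derive x 1 f a -> {for x, continuous f}.
Proof. by case=> /derivable1_diffP fx _; exact: differentiable_continuous. Qed.

Lemma sqrt1D_gt0 a : 0 < Num.sqrt (1 + a ^+ 2).
Proof. by rewrite sqrtr_gt0 ltr_pwDl// sqr_ge0. Qed.

Lemma sqrt1D_sqr a : Num.sqrt (1 + a ^+ 2) ^+ 2 = 1 + a ^+ 2.
Proof. by rewrite sqr_sqrtr// addr_ge0// sqr_ge0. Qed.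

Lemma sqrt1D_ge1 a : 1 <= Num.sqrt (1 + a ^+ 2).
Proof. by rewrite -[leLHS]sqrtr1 ler_wsqrtr// lerDl sqr_ge0. Qed.

Lemma sqrt1D_ge_norm a : `|a| <= Num.sqrt (1 + a ^+ 2).
Proof. by rewrite -sqrtr_sqr ler_wsqrtr// lerDr ler01. Qed.

Lemma sqrt1D_le a : Num.sqrt (1 + a ^+ 2) <= 1 + `|a|.
Proof.
rewrite -(@ler_pXn2r _ 2)// ?nnegrE ?addr_ge0 ?(ltW (sqrt1D_gt0 a))//.
rewrite sqrt1D_sqr -(real_normK (num_real a)); have := normr_ge0 a; nra.
Qed.

Lemma sqrt1D_neq0 a : Num.sqrt (1 + a ^+ 2) != 0.
Proof. by rewrite gt_eqF// sqrt1D_gt0. Qed.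

Lemma MVT_is_derive f df a b : a < b ->
  (forall x, a <= x <= b -> is_derive x 1 f (df x)) ->
  exists2 c, a < c < b & f b - f a = df c * (b - a).
Proof.
move=> ab fdf; have [||c] := @MVT R f df a b ab.
- by move=> x /[!in_itv]/= /andP[ax xb]; apply: fdf; rewrite !ltW.
- apply: derivable_within_continuous => x /[!in_itv]/= xab.
  by have [] := fdf x xab.
- by rewrite in_itv/= => cab ->; exists c.
Qed.

(** The endpoints may come in either order, since Danskin's argument tests points on both sides of
    the maximizer. *)
Lemma MVT_between f df a b : (forall x, is_derive x 1 f (df x)) ->
  exists2 c, Num.min a b <= c <= Num.max a b & f b - f a = df c * (b - a).
Proof.
move=> fdf; have [ab|ba|->] := ltgtP a b.
- by have [c /andP[/ltW ac /ltW cb] e] := MVT_is_derive ab (fun x _ => fdf x); exists c;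
    rewrite ?ac.
- have [c /andP[/ltW ac /ltW cb] e] := MVT_is_derive ba (fun x _ => fdf x).
  by exists c; rewrite ?ac//; apply: oppr_inj; rewrite opprB e; ring.
- by exists b; rewrite ?lexx// !subrr mulr0.
Qed.

Lemma bounded_derive_lipschitz f df K a b :
  (forall x, a <= x <= b -> is_derive x 1 f (df x)) ->
  (forall x, a <= x <= b -> `|df x| <= K) ->
  forall x y, a <= x <= b -> a <= y <= b -> `|f x - f y| <= K * `|x - y|.
Proof.
move=> fdf dfK x y; wlog yx : x y / y <= x => [hw|].
  case: (leP y x) => [yx|/ltW xy] hx hy; first exact: hw.
  by rewrite distrC (distrC x); apply: hw.
move: yx; rewrite le_eqVlt => /predU1P[->|yx]; first by rewrite !subrr normr0 mulr0.
move=> /andP[ax xb] /andP[ay yb].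
have [c /andP[yc cx] ->] : exists2 c, y < c < x & f x - f y = df c * (x - y).
  by apply: MVT_is_derive => // z /andP[yz zx]; apply: fdf; lra.
by rewrite normrM ler_wpM2r// dfK//; lra.
Qed.

(** With s = sqrt (1 + x^2) the left side is 2 ln s. This turns (b^2 - ln (1 + b^2)) / 2 into the
    perfect square (s - 1)^2 / 2 as a lower bound. *)
Lemma ln_sqrt1D_le x : ln (1 + x ^+ 2) <= 2 * (Num.sqrt (1 + x ^+ 2) - 1).
Proof.
have x0 : 0 < 1 + x ^+ 2 by rewrite ltr_pwDl// sqr_ge0.
set s := Num.sqrt _; have s0 : 0 < s by rewrite sqrtr_gt0.
rewrite -(sqr_sqrtr (ltW x0)) -/s expr2 lnM ?posrE//.
have := @le_ln1Dx R (s - 1); rewrite subrKC ltrBrDr addrC subrr s0 => /(_ isT); lra.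
Qed.

Lemma ln1D_ge x : 0 <= x -> x / (1 + x) <= ln (1 + x).
Proof.
move=> x0; have x1 : 0 < 1 + x by lra.
have -> : x / (1 + x) = - ((1 + x)^-1 - 1) by field; rewrite gt_eqF.
rewrite lerNl -lnV ?posrE//.
have := @le_ln1Dx R ((1 + x)^-1 - 1); rewrite subrKC; apply.
by rewrite ltrBrDr addrC subrr invr_gt0.
Qed.

End derivation_rules.

(** * Saddle points of a perturbed potential *)

Section abstract_saddle.
Context {R : realType}.
Implicit Types a b : R.
(** In the application [g] is E ln N(u), [A1] is E[logistic(- sqrt lambda S) A(u)], [R2] is the L^2
    norm of A(u) and [l] is sqrt lambda. One constant [L] bounds both the sizes and the Lipschitz
    constants of [A1] and [R2]. *)
Variables (g A1 R2 : R -> R -> R) (alpha l L C1 : R).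
Hypotheses (alpha_gt0 : 0 < alpha) (l_gt0 : 0 < l) (L_gt0 : 0 < L).
(** [al1] confines minimizers and maximizers, [al3] makes the equation for b a contraction at fixed
    a, and [al2] then makes the equation for a one. *)
Hypotheses (al1 : alpha * C1 <= 1 / 64)
  (al2 : alpha * l * L <= 1 / 16) (al3 : Num.sqrt alpha * L <= 1 / 4).
Hypothesis g_le0 : forall a b : R, g a b <= 0.
Hypothesis g_ge : forall a b : R, -1 <= a <= 1 -> - (C1 * (1 + b ^+ 2)) <= g a b.
Hypothesis A1_bd : forall a b : R, -1 <= a <= 1 -> 0 <= b <= 1 -> 0 < A1 a b <= L.
Hypothesis R2_bd : forall a b : R, -1 <= a <= 1 -> 0 <= b <= 1 -> 0 < R2 a b <= L.
Hypothesis A1_lip : forall a a' b b' : R, -1 <= a <= 1 -> -1 <= a' <= 1 ->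
  0 <= b <= 1 -> 0 <= b' <= 1 ->
  `|A1 a b - A1 a' b'| <= L * (`|a - a'| + `|b - b'|).
Hypothesis R2_lip : forall a a' b b' : R, -1 <= a <= 1 -> -1 <= a' <= 1 ->
  0 <= b <= 1 -> 0 <= b' <= 1 ->
  `|R2 a b - R2 a' b'| <= L * (`|a - a'| + `|b - b'|).
Hypothesis g_b : forall a b : R,
  is_derive b 1 (g a) (- (b / (1 + b ^+ 2) * R2 a b ^+ 2)).
Hypothesis g_a : forall a b : R, is_derive a 1 (g ^~ b)
  ((1 + a ^+ 2)^-1 * (Num.sqrt (1 + b ^+ 2) * l * A1 a b - a * R2 a b ^+ 2)).

Definition potential (a b : R) :=
  alpha * g a b + (2^-1 * (b ^+ 2 - ln (1 + b ^+ 2)) - 2^-1 * ln (1 + a ^+ 2)).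

Local Notation F := potential.
Let beta (b : R) : R := Num.sqrt (1 + b ^+ 2).
Let D (a b : R) := alpha * (beta b * l * A1 a b) - a * (1 + alpha * R2 a b ^+ 2).

Let beta_sqr b : beta b ^+ 2 = 1 + b ^+ 2.
Proof. exact: sqrt1D_sqr. Qed.

Let beta_ge1 b : 1 <= beta b.
Proof. exact: sqrt1D_ge1. Qed.

Let F_b a b : is_derive b 1 (F a) (b / (1 + b ^+ 2) * (b ^+ 2 - alpha * R2 a b ^+ 2)).
Proof.
have b0 : 1 + b ^+ 2 != 0 by rewrite gt_eqF// ltr_pwDl// sqr_ge0.
apply: (is_derive_eq (is_derive_add (is_derive_scale alpha (g_b a b))
  (is_derive_sub (is_derive_scale 2^-1
    (is_derive_sub (is_derive_expn 2 (is_derive_var b)) (is_derive_ln1Dsqr b)))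
    (is_derive_const (2^-1 * ln (1 + a ^+ 2)) b)))).
by rewrite /=; field.
Qed.

Let F_a a b : is_derive a 1 (F ^~ b) ((1 + a ^+ 2)^-1 * D a b).
Proof.
have a0 : 1 + a ^+ 2 != 0 by rewrite gt_eqF// ltr_pwDl// sqr_ge0.
apply: (is_derive_eq (is_derive_add (is_derive_scale alpha (g_a a b))
  (is_derive_sub (is_derive_const (2^-1 * (b ^+ 2 - ln (1 + b ^+ 2))) a)
    (is_derive_scale 2^-1 (is_derive_ln1Dsqr a))))).
by rewrite /D /beta /=; field.
Qed.

Let F0_le a : F a 0 <= - (2^-1 * ln (1 + a ^+ 2)).
Proof.
rewrite /F expr0n/= addr0 ln1 subr0 mulr0 add0r gerDr.
by rewrite pmulr_rle0.
Qed.

Let F_ge a b : -1 <= a <= 1 ->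
  2^-1 * (beta b - 1) ^+ 2 - alpha * C1 * beta b ^+ 2 - 2^-1 * ln (1 + a ^+ 2) <= F a b.
Proof.
move=> a1; rewrite /F.
have h1 : alpha * - (C1 * (1 + b ^+ 2)) <= alpha * g a b by rewrite ler_pM2l// g_ge.
have h2 := ln_sqrt1D_le b; rewrite -/(beta b) in h2.
have eb : b ^+ 2 = beta b ^+ 2 - 1 by rewrite beta_sqr; ring.
by rewrite eb subrKC in h1 h2 *; lra.
Qed.

Let F_b_large a b : -1 <= a <= 1 -> 1 <= b -> F a 0 < F a b.
Proof.
move=> a1 b1; apply: le_lt_trans (F0_le a) _; apply: lt_le_trans (F_ge b a1).
have h1 := beta_sqr b; have h2 := beta_ge1 b.
(* From beta >= 4/3 follows beta - 1 >= beta / 4, so the square term is at least beta^2 / 32, twice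
   the loss that [al1] allows. *)
have h3 : 4 / 3 <= beta b by nra.
rewrite ltrBrDr addNr subr_gt0.
have h5 : 0 < beta b ^+ 2 by nra.
have : alpha * C1 * beta b ^+ 2 <= 1 / 64 * beta b ^+ 2 by rewrite ler_wpM2r// ltW.
nra.
Qed.

Definition minimizer (a b : R) := 0 <= b /\ forall b', 0 <= b' -> F a b <= F a b'.

(** Beyond |a| = 1 no lower bound on g is at hand, but at b = 0 only g <= 0 is used. Against - 1/32
    from [F_0_ge], this bars such a from being maximizers. *)
Let F_a_far a : 1 <= `|a| -> F a 0 <= - (1 / 4).
Proof.
move=> a1; apply: le_trans (F0_le a) _.
have a2 : 1 <= a ^+ 2 by rewrite -real_normK ?num_real//; nra.
have := @ln1D_ge R _ (sqr_ge0 a).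
have : 1 / 2 <= a ^+ 2 / (1 + a ^+ 2) by rewrite ler_pdivlMr; lra.
lra.
Qed.

Let F_0_ge b : - (1 / 32) <= F 0 b.
Proof.
have /(@F_ge _ b) : -1 <= (0 : R) <= 1 by rewrite lerN10 ler01.
rewrite expr0n/= addr0 ln1 mulr0 subr0; apply: le_trans.
have h1 := beta_ge1 b; set t := beta b in h1 *.
have h2 : alpha * C1 * t ^+ 2 <= 1 / 64 * t ^+ 2 by rewrite ler_wpM2r// sqr_ge0.
(* 32/31 minimizes (t - 1)^2 / 2 - t^2 / 64, whose minimum is - 1/62. *)
have := sqr_ge0 (t - 32 / 31); lra.
Qed.

Let ex_minimizer a : -1 <= a <= 1 -> exists b, minimizer a b.
Proof.
move=> a1.
have [||b] := @EVT_min R (F a) 0 1.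
- exact: ler01.
- by apply: derivable_within_continuous => x _; have [] := F_b a x.
rewrite in_itv/= => /andP[b0 b1] hb; exists b; split=> // b' b'0.
have [b'1|/ltW b'1] := leP b' 1; first by apply: hb; rewrite in_itv/= b'0.
apply: le_trans (ltW (F_b_large a1 b'1)); apply: hb.
by rewrite in_itv/= lexx ler01.
Qed.

Let minimizer_lt1 a b : -1 <= a <= 1 -> minimizer a b -> b < 1.
Proof.
move=> a1 [b0 hb]; rewrite ltNge; apply/negP => /(F_b_large a1).
by rewrite ltNge hb.
Qed.

Let sqrt_alpha_gt0 : 0 < Num.sqrt alpha. Proof. by rewrite sqrtr_gt0. Qed.

Let sqrt_alpha_sqr : Num.sqrt alpha ^+ 2 = alpha.
Proof. by rewrite sqr_sqrtr// ltW. Qed.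

(** Near b = 0 the slope has the sign of b^2 - alpha R2^2, which is negative there because [R2] is
    positive at b = 0 and Lipschitz; so the potential first decreases. *)
Let minimizer_gt0 a b : -1 <= a <= 1 -> minimizer a b -> 0 < b.
Proof.
move=> a1 [b0 hb]; rewrite lt_neqAle b0 andbT; apply/eqP => b00; subst b.
have I0 : 0 <= (0 : R) <= 1 by rewrite lexx ler01.
have /andP[r0 _] := R2_bd a1 I0.
(* For 0 < c < e, [al3] gives s R2(a, c) >= s R2(a, 0) - c / 4 > 2 c - c / 4 > c, so the slope at c
   is negative. The bound 1/2 keeps c inside [0, 1]. *)
set s := Num.sqrt alpha; pose e := Num.min (1/2) (s * R2 a 0 / 2).
have e0 : 0 < e by rewrite lt_min divr_gt0 ?divr_gt0 ?mulr_gt0.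
have e1 : e <= 1 / 2 by rewrite ge_min lexx.
have e2 : e <= s * R2 a 0 / 2 by rewrite ge_min lexx orbT.
have [c /andP[c0 ce]] := MVT_is_derive e0 (fun x _ => F_b a x).
have := hb e (ltW e0); rewrite -subr_ge0 => /[swap] ->; rewrite subr0.
rewrite pmulr_lge0// leNgt => /negP; apply.
have c1 : 0 <= c <= 1 by lra.
rewrite pmulr_rlt0; last by rewrite divr_gt0// ltr_pwDl// sqr_ge0.
have := R2_lip a1 a1 I0 c1; rewrite subrr normr0 add0r sub0r normrN (gtr0_norm c0).
move=> /ler_normlP[_ h].
have h1 : s * R2 a 0 - s * R2 a c <= c / 4.
  rewrite -mulrBr; apply: le_trans (_ : s * (L * c) <= _); first by rewrite ler_pM2l.
  by rewrite mulrA; have : s * L * c <= 1 / 4 * c; [rewrite ler_wpM2r// ltW | lra].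
have h2 : c < s * R2 a c by lra.
rewrite subr_lt0 -sqrt_alpha_sqr -exprMn ltrXn2r// ?nnegrE ltW// (lt_trans c0)//.
Qed.

Let minimizer_eq a b : -1 <= a <= 1 -> minimizer a b -> b = Num.sqrt alpha * R2 a b.
Proof.
move=> a1 mb; have b0 := minimizer_gt0 a1 mb; have b1 := minimizer_lt1 a1 mb.
have hd : is_derive b 1 (F a) 0.
  apply: (derive1_at_min ler01).
  - by move=> t _; have [] := F_b a t.
  - by rewrite in_itv/= b0 b1.
  - by move=> t; rewrite in_itv/= => /andP[/ltW t0 _]; case: mb => _; apply.
have := @derive_val _ _ _ _ _ _ _ (F_b a b); rewrite derive_val => /esym/eqP.
rewrite mulf_eq0 mulf_eq0 (gt_eqF b0)/= invr_eq0 gt_eqF/=; last by rewrite ltr_pwDl// sqr_ge0.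
have /andP[r0 _] : 0 < R2 a b <= L by apply: R2_bd => //; rewrite !ltW.
rewrite -sqrt_alpha_sqr -exprMn subr_eq0 eqrXn2 ?(ltW b0) ?mulr_ge0 ?(ltW r0)//.
by rewrite sqrt_alpha_sqr => /eqP.
Qed.

(** The map b to sqrt alpha R2 has Lipschitz constant 1/4 in a and in b, hence 3/4 |b - b'| <= 1/4
    |a - a'|; the factor 1/2 is a rounded 1/3. *)
Let fixpoint_lip a a' b b' : -1 <= a <= 1 -> -1 <= a' <= 1 ->
  0 <= b <= 1 -> 0 <= b' <= 1 ->
  b = Num.sqrt alpha * R2 a b -> b' = Num.sqrt alpha * R2 a' b' ->
  `|b - b'| <= `|a - a'| / 2.
Proof.
move=> ha ha' hb hb' eb eb'.
have h : `|b - b'| <= 1 / 4 * (`|a - a'| + `|b - b'|).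
  rewrite {1}eb {1}eb' -mulrBr normrM (gtr0_norm sqrt_alpha_gt0).
  apply: le_trans (_ : Num.sqrt alpha * (L * (`|a - a'| + `|b - b'|)) <= _).
    by rewrite ler_pM2l// R2_lip.
  by rewrite mulrA ler_wpM2r// addr_ge0.
have := normr_ge0 (a - a'); lra.
Qed.

Let beta_lip b b' : `|beta b - beta b'| <= `|b - b'|.
Proof.
have h : forall x, `|x / beta x| <= 1.
  move=> x; rewrite normf_div (ger0_norm (le_trans ler01 (beta_ge1 x))).
  rewrite ler_pdivrMr ?mul1r ?(lt_le_trans ltr01)//.
  by rewrite -sqrtr_sqr ler_wsqrtr// lerDr ler01.
have := @bounded_derive_lipschitz R beta _ 1 (Num.min b b') (Num.max b b')
  (fun x _ => is_derive_sqrt1Dsqr x) (fun x _ => h x) b b'.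
by rewrite mul1r; apply; rewrite ?ge_min ?le_max !lexx ?orbT.
Qed.

Let beta_le2 b : 0 <= b <= 1 -> beta b <= 2.
Proof. by move=> /andP[b0 b1]; have := beta_sqr b; have := beta_ge1 b; nra. Qed.

(** [K] need not be small: it only serves the continuity of the infimum over b and the quadratic
    error in Danskin's argument. *)
Let D_lip : exists2 K, 0 < K & forall a a' b b', -1 <= a <= 1 -> -1 <= a' <= 1 ->
  0 <= b <= 1 -> 0 <= b' <= 1 ->
  `|D a b - D a' b'| <= K * (`|a - a'| + `|b - b'|).
Proof.
exists (alpha * l * (3 * L) + 1 + alpha * (3 * L ^+ 2)).
  by rewrite !addr_gt0 ?mulr_gt0// exprn_gt0.
move=> a a' b b' ha ha' hb hb'; set d := `|a - a'| + `|b - b'|.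
have da : `|a - a'| <= d by rewrite lerDl.
have db : `|b - b'| <= d by rewrite lerDr.
have d0 : 0 <= d by rewrite addr_ge0.
have /andP[p1 p2] := A1_bd ha hb; have /andP[p3 p4] := A1_bd ha' hb'.
have /andP[q1 q2] := R2_bd ha hb; have /andP[q3 q4] := R2_bd ha' hb'.
have -> : D a b - D a' b' = alpha * l * (beta b * (A1 a b - A1 a' b')
    + (beta b - beta b') * A1 a' b') - (a - a')
  - alpha * ((a - a') * R2 a b ^+ 2
    + a' * ((R2 a b - R2 a' b') * (R2 a b + R2 a' b'))).
  by rewrite /D; ring.
have al0 : 0 < alpha * l by rewrite mulr_gt0.
have LL : 0 < L ^+ 2 by rewrite exprn_gt0.
have e1 : `|beta b * (A1 a b - A1 a' b') + (beta b - beta b') * A1 a' b'| <= 3 * L * d.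
  apply: le_trans (ler_normD _ _) _; rewrite !normrM (gtr0_norm p3).
  rewrite (ger0_norm (le_trans ler01 (beta_ge1 b))).
  have -> : 3 * L * d = 2 * (L * d) + d * L by ring.
  have k1 : `|A1 a b - A1 a' b'| <= L * d by exact: A1_lip.
  have k2 : `|beta b - beta b'| <= d by exact: le_trans (beta_lip _ _) db.
  have k3 := beta_le2 hb; have k4 := le_trans ler01 (beta_ge1 b).
  by apply: lerD; apply: ler_pM => //; exact: ltW.
have e2 : `|(a - a') * R2 a b ^+ 2
    + a' * ((R2 a b - R2 a' b') * (R2 a b + R2 a' b'))| <= 3 * L ^+ 2 * d.
  apply: le_trans (ler_normD _ _) _.
  rewrite normrM (ger0_norm (sqr_ge0 (R2 a b))) !normrM.
  have -> : 3 * L ^+ 2 * d = d * L ^+ 2 + 1 * ((L * d) * (L + L)) by ring.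
  apply: lerD.
    apply: ler_pM; rewrite ?sqr_ge0//.
    by rewrite lerXn2r// nnegrE ltW.
  have k4 : `|a'| <= 1 by rewrite ler_norml.
  have k5 : `|R2 a b - R2 a' b'| <= L * d by exact: R2_lip.
  have k6 : `|R2 a b + R2 a' b'| <= L + L by rewrite ger0_norm ?addr_ge0 ?lerD// ltW.
  by apply: ler_pM => //; apply: ler_pM.
have f1 := ler_wpM2l (ltW al0) e1; have f2 := ler_wpM2l (ltW alpha_gt0) e2.
apply: le_trans (ler_normB _ _) _; rewrite normrM (gtr0_norm alpha_gt0).
have -> : (alpha * l * (3 * L) + 1 + alpha * (3 * L ^+ 2)) * d =
  alpha * l * (3 * L * d) + d + alpha * (3 * L ^+ 2 * d) by ring.
apply: lerD => //; apply: le_trans (ler_normB _ _) _; rewrite normrM (gtr0_norm al0).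
exact: lerD.
Qed.

Let F_lip : exists2 K, 0 < K & forall a a' b, -1 <= a <= 1 -> -1 <= a' <= 1 ->
  0 <= b <= 1 -> `|F a b - F a' b| <= K * `|a - a'|.
Proof.
have [K K0 hK] := D_lip; exists (`|D 0 0| + 2 * K); first by rewrite ltr_wpDl// mulr_gt0.
move=> a a' b ha ha' hb.
have I0 : 0 <= (0 : R) <= 1 by rewrite lexx ler01.
have I1 : -1 <= (0 : R) <= 1 by rewrite lerN10 ler01.
apply: (bounded_derive_lipschitz (fun x _ => F_a x b)) ha ha' => x hx.
have x0 : 1 <= 1 + x ^+ 2 by rewrite lerDl sqr_ge0.
rewrite normrM normfV (ger0_norm (le_trans ler01 x0)) mulrC.
rewrite ler_pdivrMr ?(lt_le_trans ltr01)//.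
have h1 : `|D x b| <= `|D 0 0| + 2 * K.
  have -> : D x b = D 0 0 + (D x b - D 0 0) by ring.
  apply: le_trans (ler_normD _ _) _; rewrite lerD2l.
  apply: le_trans (hK _ _ _ _ hx I1 hb I0) _; rewrite !subr0 mulrC ler_pM2r//.
  have : `|x| <= 1 by rewrite ler_norml.
  have : `|b| <= 1 by rewrite ler_norml; lra.
  lra.
apply: le_trans h1 _; rewrite ler_peMr// addr_ge0// mulr_ge0// ltW//.
Qed.

(** The value at a minimizer is the infimum over b, so this says that a maximizes that infimum on
    [-1, 1] without naming the infimum. *)
Definition maximizer a b := [/\ -1 <= a <= 1, minimizer a b &
  forall a' b', -1 <= a' <= 1 -> minimizer a' b' -> F a' b' <= F a b].

(** The chosen minimizer [bm] may depend on a in any way; its value [M] is nevertheless Lipschitz,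
    as an infimum of functions that are Lipschitz in a uniformly in b. The extreme value theorem
    then applies to [M]. *)
Let ex_maximizer : exists a b, maximizer a b.
Proof.
have /choice[bm hbm] : forall a, exists b, -1 <= a <= 1 -> minimizer a b.
  move=> a.
  by have [/ex_minimizer[b hb]|na] := pselect (-1 <= a <= 1); [exists b|exists 0].
pose M a := F a (bm a).
have [K K0 hK] := F_lip.
have hb01 a : -1 <= a <= 1 -> 0 <= bm a <= 1.
  move=> ha; have hm := hbm a ha; rewrite (ltW (minimizer_lt1 ha hm)) andbT.
  by case: hm.
have Mle a a' : -1 <= a <= 1 -> -1 <= a' <= 1 -> M a - M a' <= K * `|a - a'|.
  move=> ha ha'.
  apply: le_trans (_ : F a (bm a') - F a' (bm a') <= _).
    by rewrite lerD2r; have [_] := hbm a ha; apply; have [] := hbm a' ha'.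
  by apply: le_trans (ler_norm _) _; apply: hK => //; exact: hb01.
have Mlip a a' : -1 <= a <= 1 -> -1 <= a' <= 1 -> `|M a - M a'| <= K * `|a - a'|.
  move=> ha ha'; rewrite ler_norml Mle// andbT lerNl opprB distrC; exact: Mle.
have [||a] := @EVT_max R M (-1) 1.
- by lra.
- apply/subspace_continuousP => x; rewrite /= in_itv/= => hx.
  apply/cvgrPdist_le => e e0; rewrite near_withinE.
  near=> y; rewrite /= in_itv/= => hy.
  apply: le_trans (Mlip _ _ hx hy) _; rewrite mulrC -ler_pdivlMr//.
  near: y; apply: cvgr_dist_le; last exact: divr_gt0.
  exact: cvg_id.
rewrite in_itv/= => ha hmax; exists a, (bm a); split => //; first exact: hbm.
move=> a' b' ha' [b'0 hb']; apply: le_trans (hmax a' _); last by rewrite in_itv.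
by apply: hb'; have [] := hbm a' ha'.
Unshelve. all: by end_near. Qed.

Let maximizer_ge a b : maximizer a b -> - (1 / 32) <= F a b.
Proof.
case=> _ _ h; have I1 : -1 <= (0 : R) <= 1 by rewrite lerN10 ler01.
have [b' hb'] := ex_minimizer I1; exact: le_trans (F_0_ge b') (h _ _ I1 hb').
Qed.

Let maximizer_interior a b : maximizer a b -> -1 < a < 1.
Proof.
move=> hm; have := maximizer_ge hm; rewrite -ltr_norml ltNge => h1.
apply/negP => /F_a_far h2; case: hm => _ [_ h] _; have := h 0 (lexx 0); lra.
Qed.

(* Danskin's argument: the minimizers over [b] depend continuously on [a], so
   the partial derivative in [a] vanishes at a maximizer of the infimum. *)
Let maximizer_crit a b : maximizer a b -> D a b = 0.
Proof.
move=> hm; have /andP[a1 a2] := maximizer_interior hm; case: (hm) => ha hb h.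
have hb01 : 0 <= b <= 1 by rewrite (ltW (minimizer_lt1 ha hb)) andbT; case: hb.
have [K K0 hK] := D_lip.
(* As F a' b' <= F a b <= F a b', the mean value theorem at fixed b' gives the sign of (a' - a) D at
   some c between a and a'. Replacing D c b' by D a b costs a multiple of |a' - a|, because b' stays
   within |a' - a| / 2 of b. *)
have key a' : -1 <= a' <= 1 -> (a' - a) * D a b <= 2 * K * `|a' - a| ^+ 2.
  move=> ha'; have [b' hb'] := ex_minimizer ha'.
  have hb'01 : 0 <= b' <= 1 by rewrite (ltW (minimizer_lt1 ha' hb')) andbT; case: hb'.
  have h1 : F a' b' - F a b' <= 0.
    rewrite subr_le0; apply: le_trans (h _ _ ha' hb') _.
    by case: hb => _; apply; case/andP: hb'01.
  have hbb := fixpoint_lip ha' ha hb'01 hb01 (minimizer_eq ha' hb') (minimizer_eq ha hb).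
  have [c hc e] := MVT_between a a' (fun x => F_a x b').
  have hca : `|c - a| <= `|a' - a|.
    move: hc; rewrite ler_norml; have [aa|aa] := leP a a' => hc.
      by rewrite ger0_norm; lra.
    by rewrite ler0_norm; lra.
  have hc1 : -1 <= c <= 1.
    by move: hc; have [aa|aa] := leP a a' => hc; lra.
  have h2 : (a' - a) * D c b' <= 0.
    move: h1; rewrite e -mulrA pmulr_rle0 1?mulrC//.
    by rewrite invr_gt0 ltr_pwDl// sqr_ge0.
  have h3 : `|D c b' - D a b| <= 2 * K * `|a' - a|.
    apply: le_trans (hK _ _ _ _ hc1 ha hb'01 hb01) _.
    rewrite (mulrC 2) -mulrA ler_pM2l//; have := normr_ge0 (a' - a); lra.
  have -> : (a' - a) * D a b = (a' - a) * D c b' - (a' - a) * (D c b' - D a b) by ring.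
  apply: le_trans (_ : `|(a' - a) * (D c b' - D a b)| <= _).
    by have := ler_norm (- ((a' - a) * (D c b' - D a b))); rewrite normrN; lra.
  by rewrite normrM expr2 mulrA mulrC ler_wpM2r.
apply/eqP/negPn/negP => D0; have nD : 0 < `|D a b| by rewrite normr_gt0.
(* A step of length e in the direction of the sign of D a b turns [key] into e |D a b| <= 2 K e^2 <=
   e |D a b| / 2. The first two bounds on e keep the test point in [-1, 1]. *)
pose e := Num.min (Num.min (1 - a) (a + 1)) (`|D a b| / (4 * K)).
have e0 : 0 < e by rewrite !lt_min divr_gt0 ?mulr_gt0//; lra.
have e1 : e <= 1 - a by rewrite !ge_min lexx.
have e2 : e <= a + 1 by rewrite !ge_min lexx orbT.
have e3 : e * (4 * K) <= `|D a b| by rewrite -ler_pdivlMr ?mulr_gt0// ge_min lexx orbT.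
have : e * `|D a b| <= 2 * K * e ^+ 2.
  have [D1|D1] := leP 0 (D a b).
    rewrite (ger0_norm D1); have := key (a + e).
    rewrite [a + e - a](_ : _ = e); last by ring.
    by rewrite (gtr0_norm e0); apply; lra.
  rewrite (ltr0_norm D1); have := key (a - e).
  rewrite [a - e - a](_ : _ = - e); last by ring.
  by rewrite normrN (gtr0_norm e0) mulNr mulrN; apply; lra.
have -> : 2 * K * e ^+ 2 = e * (e * (4 * K)) / 2 by field.
rewrite -mulrA ler_pM2l//; lra.
Qed.

(** At a minimizer alpha R2^2 = b^2, so the factor 1 + alpha R2^2 in D is beta^2 and one beta
    cancels. *)
Let maximizer_eq a b : maximizer a b -> a = alpha * l * (A1 a b / beta b).
Proof.
move=> hm; have := maximizer_crit hm; case: hm => ha hb _.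
have := minimizer_eq ha hb => /(congr1 (fun x => x ^+ 2)).
rewrite exprMn sqrt_alpha_sqr /D => <-; rewrite -beta_sqr => /eqP.
rewrite subr_eq0 => /eqP e.
have b0 : beta b != 0 by rewrite gt_eqF// (lt_le_trans ltr01).
apply: (mulIf b0); apply: (mulIf b0); rewrite -mulrA -expr2 -e; field.
exact: b0.
Qed.

(** With |b - b'| <= |a - a'| / 2 the equation for a yields |a - a'| <= (1/16) (|a - a'| + 2 |b -
    b'|) <= |a - a'| / 8. *)
Let maximizer_unique a b a' b' : maximizer a b -> maximizer a' b' -> a = a'.
Proof.
move=> hm hm'; have ea := maximizer_eq hm; have ea' := maximizer_eq hm'.
case: hm => ha hb _; case: hm' => ha' hb' _.
have hb01 : 0 <= b <= 1 by rewrite (ltW (minimizer_lt1 ha hb)) andbT; case: hb.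
have hb'01 : 0 <= b' <= 1 by rewrite (ltW (minimizer_lt1 ha' hb')) andbT; case: hb'.
have hbb := fixpoint_lip ha ha' hb01 hb'01 (minimizer_eq ha hb) (minimizer_eq ha' hb').
have h1 := A1_lip ha ha' hb01 hb'01; have h2 := beta_lip b b'.
have al0 : 0 < alpha * l by rewrite mulr_gt0.
have g1 := beta_ge1 b; have g2 := beta_ge1 b'.
have /andP[p3 p4] := A1_bd ha' hb'01.
have b0 : 0 < beta b by lra. have b'0 : 0 < beta b' by lra.
have e : A1 a b / beta b - A1 a' b' / beta b' =
  (A1 a b - A1 a' b') / beta b - A1 a' b' * (beta b - beta b') / (beta b * beta b').
  by field; rewrite !gt_eqF.
have k1 : `|(A1 a b - A1 a' b') / beta b| <= L * (`|a - a'| + `|b - b'|).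
  rewrite normf_div (gtr0_norm b0) ler_pdivrMr//; apply: le_trans h1 _.
  by rewrite ler_peMr// mulr_ge0 ?(ltW L_gt0)// addr_ge0.
have k2 : `|A1 a' b' * (beta b - beta b') / (beta b * beta b')| <= L * `|b - b'|.
  have bb : 0 < beta b * beta b' by rewrite mulr_gt0.
  rewrite normf_div (gtr0_norm bb) ler_pdivrMr// normrM (gtr0_norm p3).
  rewrite -[leLHS]mulr1; apply: ler_pM => //; rewrite ?mulr_ge0 ?(ltW p3)//.
    by apply: ler_pM => //; exact: ltW.
  by rewrite mulr_ege1.
have : `|a - a'| <= alpha * l * (L * (`|a - a'| + `|b - b'|) + L * `|b - b'|).
  rewrite {1}ea {1}ea' -mulrBr normrM (gtr0_norm al0) ler_pM2l// e.
  by apply: le_trans (ler_normB _ _) _; exact: lerD.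
have -> : alpha * l * (L * (`|a - a'| + `|b - b'|) + L * `|b - b'|) =
  alpha * l * L * (`|a - a'| + 2 * `|b - b'|) by ring.
have : alpha * l * L * (`|a - a'| + 2 * `|b - b'|) <= 1 / 16 * (`|a - a'| + 2 * `|b - b'|).
  by rewrite ler_wpM2r// addr_ge0// mulr_ge0.
move=> k3 k4; apply/eqP; rewrite -subr_eq0 -normr_le0; lra.
Qed.

(** The last four clauses express inf and sup by inequalities between values of the potential, over
    all real a and all b >= 0, so that they transfer to any parametrization with values in the
    extended reals. *)
Theorem saddle_point_potential : exists a b,
  [/\ 0 < a, 0 < b, a = alpha * l * (A1 a b / Num.sqrt (1 + b ^+ 2)) &
      b ^+ 2 = alpha * R2 a b ^+ 2] /\
  [/\ forall b', 0 <= b' -> F a b <= F a b',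
     forall b', 0 <= b' -> F a b' = F a b -> b' = b,
     forall a', exists2 b', 0 <= b' & F a' b' <= F a b &
     forall a', (forall b', 0 <= b' -> F a b <= F a' b') -> a' = a].
Proof.
have [a [b hm]] := ex_maximizer; exists a, b.
have ea := maximizer_eq hm; case: (hm) => ha hb h.
have b0 := minimizer_gt0 ha hb; have eb := minimizer_eq ha hb.
have hb01 : 0 <= b <= 1 by rewrite (ltW (minimizer_lt1 ha hb)) (ltW b0).
have /andP[p1 _] := A1_bd ha hb01.
split; split => //.
- by rewrite ea !mulr_gt0// invr_gt0 (lt_le_trans ltr01).
- by rewrite {1}eb exprMn sqrt_alpha_sqr.
- by case: hb.
- move=> b' b'0 e; have hb' : minimizer a b' by split=> //; rewrite e; case: hb.
  have hb'01 : 0 <= b' <= 1 by rewrite (ltW (minimizer_lt1 ha hb')) b'0.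
  have := fixpoint_lip ha ha hb'01 hb01 (minimizer_eq ha hb') eb.
  by rewrite subrr normr0 mul0r normr_le0 subr_eq0 => /eqP.
- move=> a'; have [/ltW/F_a_far a'1|] := ltP 1 `|a'|.
    by exists 0 => //; have := maximizer_ge hm; lra.
  rewrite ler_norml => ha'; have [b' hb'] := ex_minimizer ha'.
  by exists b'; [case: hb'|exact: h].
(* Such an a' lies inside (-1, 1) by [F_a_far], and any minimizer over it forms a maximizer with it;
   uniqueness concludes. *)
- move=> a' ha'.
  have a'1 : `|a'| < 1.
    rewrite ltNge; apply/negP => /F_a_far; have := maximizer_ge hm.
    by have := ha' 0 (lexx 0); lra.
  have {}a'1 : -1 <= a' <= 1 by rewrite -ler_norml ltW.
  have [b' hb'] := ex_minimizer a'1.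
  apply: (@maximizer_unique a' b' a b) => //; split => // a2 b2 ha2 hb2.
  by apply: le_trans (h _ _ ha2 hb2) _; apply: ha'; case: hb'.
Qed.

End abstract_saddle.

(** * The inverse Mills ratio *)

Section mills_ratio.
Context {R : realType}.
Implicit Types x z u : R.
Local Notation f := (@gauss_density R).
Local Notation N := (@gauss_tail R).
Local Notation A := (@inv_mills R).

Lemma gauss_density_gt0 z : 0 < f z.
Proof. by rewrite /gauss_density divr_gt0 ?expR_gt0// sqrtr_gt0 mulr_gt0// pi_gt0. Qed.

Lemma gauss_density_le z : f z * (1 + z ^+ 2 / 2) <= 1.
Proof.
have e := expR_ge1Dx (z ^+ 2 / 2).
have s1 : 1 <= Num.sqrt (2 * pi) :> R.
  by rewrite -[leLHS]sqrtr1 ler_wsqrtr//; have := pi_ge2 R; lra.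
have s0 : 0 < Num.sqrt (2 * pi) :> R by lra.
rewrite /gauss_density expRN mulrAC ler_pdivrMr// mul1r.
rewrite mulrC ler_pdivrMr ?expR_gt0//.
by apply: le_trans e _; rewrite ler_peMl// expR_ge0.
Qed.

Lemma is_derive_gauss_density z : is_derive z 1 f (- (z * f z)).
Proof.
have h : is_derive z 1 (fun y : R => - (y ^+ 2 / 2)) (- z).
  rewrite [X in is_derive _ _ X _](_ : _ = fun y : R => - 2^-1 * y ^+ 2); last first.
    by apply/funext => y; rewrite mulNr mulrC.
  apply: (is_derive_eq (is_derive_scale _ (is_derive_expn 2 (is_derive_var z)))).
  by rewrite /=; field.
have := is_derive_scale (Num.sqrt (2 * pi))^-1 (is_derive_comp h (is_derive_expR _)).
rewrite [X in is_derive _ _ X _ -> _](_ : _ = f); last first.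
  by apply/funext => y; rewrite /gauss_density mulrC.
by move=> h'; apply: (is_derive_eq h'); rewrite /gauss_density; ring.
Qed.

Lemma measurable_gauss_density : measurable_fun setT f.
Proof. by rewrite gauss_densityE; exact: measurable_normal_pdf. Qed.

Lemma integrable_gauss_density :
  (@lebesgue_measure R).-integrable setT (EFin \o f).
Proof. by rewrite gauss_densityE; exact: integrable_normal_pdf. Qed.

Lemma is_derive_gauss_tail x : is_derive x 1 N (- f x).
Proof.
have intT := integrable_gauss_density.
pose F y := \int[lebesgue_measure]_(z in `]-oo, y]) f z.
have -> : N = (fun y => \int[lebesgue_measure]_z f z - F y).
  apply/funext => y; apply/eqP; rewrite eq_sym subr_eq; apply/eqP.
  rewrite /F /gauss_tail -(@Rintegral_itv_bndo_bndc _ -oo%O y); last first.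
    exact: integrableS intT.
  rewrite addrC -Rintegral_setU//=.
  - by rewrite -itv_bndbnd_setU//= set_itvNyy.
  - by apply: integrableS intT => //; exact: measurableU.
  - apply/disj_set2P; rewrite -subset0 => z [] /=.
    by rewrite !in_itv/= andbT => zy /(lt_le_trans zy); rewrite ltxx.
have [dF F'x] : derivable F x 1 /\ derive1 F x = f x.
  apply: (@continuous_FTC1 _ _ -oo%O x (x + 1)) => //; rewrite ?ltrDl//.
  - exact: integrableS intT.
  - by rewrite ltNyr.
  - exact: is_derive_continuous (is_derive_gauss_density x).
have dFx : is_derive x 1 F (f x) by apply: DeriveDef => //; rewrite -F'x derive1E.
exact: (is_derive_eq (is_derive_sub (is_derive_const _ x) dFx) (sub0r _)).
Qed.

Lemma gauss_tail_ge0 x : 0 <= N x.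
Proof. by apply: Rintegral_ge0 => z _; rewrite ltW// gauss_density_gt0. Qed.

Lemma gauss_tail_decr x y : x < y -> N y < N x.
Proof.
move=> xy; have [c _ e] := MVT_is_derive xy (fun x _ => is_derive_gauss_tail x).
by rewrite -subr_lt0 e mulNr oppr_lt0 mulr_gt0 ?gauss_density_gt0// subr_gt0.
Qed.

Lemma gauss_tail_gt0 x : 0 < N x.
Proof. by apply: le_lt_trans (gauss_tail_ge0 (x + 1)) _; rewrite gauss_tail_decr// ltrDl. Qed.

Lemma gauss_tailE x : (N x)%:E = (\int[lebesgue_measure]_(z in `[x, +oo[) (f z)%:E)%E.
Proof.
rewrite /gauss_tail /Rintegral fineK//; apply: integrable_fin_num => //.
exact: integrableS integrable_gauss_density.
Qed.

Lemma gauss_tail_le1 x : N x <= 1.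
Proof.
rewrite -lee_fin gauss_tailE -(@integral_normal_pdf R 0 1) -gauss_densityE.
apply: ge0_subset_integral => //.
- by apply/measurable_EFinP; exact measurable_gauss_density.
- by move=> z _; rewrite lee_fin ltW// gauss_density_gt0.
Qed.

Lemma gauss_density_cvg0 (c : R -> R) :
  (\forall x \near +oo, 0 <= c x <= x) -> c x * f x @[x --> +oo] --> 0.
Proof.
move=> hc; apply/cvgrPdist_le => e e0; near=> x.
have /andP[c0 cx] : 0 <= c x <= x by near: x.
have x0 : 0 < x by near: x; apply: nbhs_pinfty_gt; exact: num_real.
rewrite sub0r normrN ger0_norm ?mulr_ge0 ?(ltW (gauss_density_gt0 _))//.
apply: le_trans (_ : x * f x <= _); first by rewrite ler_wpM2r// ltW// gauss_density_gt0.
have xe : 2 / e <= x by near: x; apply: nbhs_pinfty_ge; exact: num_real.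
have fx := gauss_density_le x; have fx0 := gauss_density_gt0 x.
have h : x * (x * f x) <= 2 by rewrite expr2 in fx; nra.
rewrite ler_pdivrMr// in xe.
rewrite -(ler_pM2l x0); apply: le_trans h _; lra.
Unshelve. all: by end_near. Qed.

Lemma integral_tail_FTC (k F : R -> R) x :
  (forall z, is_derive z 1 F (k z)) -> continuous k ->
  (forall z, x <= z -> 0 <= k z) -> F z @[z --> +oo] --> 0 ->
  (\int[lebesgue_measure]_(z in `[x, +oo[) (k z)%:E)%E = (- F x)%:E.
Proof.
move=> Fk ck k0 Foo; rewrite (ge0_continuous_FTC2y k0 _ Foo).
- by rewrite sub0e EFinN.
- exact: continuous_subspaceT.
- by move=> z _; have [] := Fk z.
- exact: cvg_at_right_filter (is_derive_continuous (Fk x)).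
- by move=> z _; rewrite derive1E; have [_] := Fk z.
Qed.

(** Integrate x f(z) <= z f(z) over z >= x; the right side has antiderivative - f. *)
Lemma gauss_tail_ub x : 0 <= x -> x * N x <= f x.
Proof.
move=> x0; have dF z : is_derive z 1 (fun y => - f y) (z * f z).
  have := is_derive_scale (-1) (is_derive_gauss_density z).
  rewrite mulN1r opprK; congr is_derive; apply/funext => y; exact: mulN1r.
have ck : continuous (fun z => z * f z).
  move=> z; exact: is_derive_continuous (is_derive_mul (is_derive_var z) (is_derive_gauss_density z)).
have k0 z : x <= z -> 0 <= z * f z.
  by move=> xz; rewrite mulr_ge0//; [exact: le_trans x0 xz|exact/ltW/gauss_density_gt0].
have Foo : - f z @[z --> +oo] --> 0.
  rewrite -oppr0; apply: cvgN.
  have -> : f = (fun z => 1 * f z) by apply/funext => z; rewrite mul1r.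
  apply: gauss_density_cvg0; near=> z; rewrite ler01/=; near: z; apply: nbhs_pinfty_ge;
    exact: num_real.
have := integral_tail_FTC dF ck k0 Foo; rewrite opprK -lee_fin => <-.
rewrite EFinM gauss_tailE -ge0_integralZl//=.
- apply: ge0_le_integral => //=.
  + by move=> z _; rewrite -EFinM lee_fin mulr_ge0// ltW// gauss_density_gt0.
  + apply/measurable_funTS/measurable_EFinP;
      exact (measurable_funM (measurable_cst x) measurable_gauss_density).
  + apply/measurable_funTS/measurable_EFinP.
    exact (measurable_funM (@measurable_id _ _ _) measurable_gauss_density).
  + move=> z; rewrite ?in_itv/= ?andbT -EFinM lee_fin => xz.
    by rewrite ler_wpM2r// ltW// gauss_density_gt0.
- by apply/measurable_funTS/measurable_EFinP; exact measurable_gauss_density.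
- by move=> z _; rewrite lee_fin ltW// gauss_density_gt0.
Unshelve. all: by end_near. Qed.

(** The function - z f(z) / (1 + z^2) has derivative h f with h = 1 - 2 / (1 + z^2)^2 <= 1, so
    integrating h f <= f over the tail gives the claim. From z >= 1 on, h is nonnegative, which the
    integration up to infinity asks for. *)
Lemma gauss_tail_lb x : 1 <= x -> x / (1 + x ^+ 2) * f x <= N x.
Proof.
move=> x1; have p z : 0 < 1 + z ^+ 2 :> R by rewrite ltr_pwDl// sqr_ge0.
pose h z : R := 1 - 2 * ((1 + z ^+ 2)^-1) ^+ 2.
have dF z : is_derive z 1 (fun y => - (y / (1 + y ^+ 2) * f y)) (h z * f z).
  have d1 := is_derive_mul (is_derive_mul (is_derive_var z)
    (is_derive_inv (is_derive_1Dsqr z) (lt0r_neq0 (p z)))) (is_derive_gauss_density z).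
  have d2 := is_derive_sub (is_derive_const 0 z) d1.
  rewrite [X in is_derive _ _ X _](_ : _ =
    fun y => 0 - y * (1 + y ^+ 2)^-1 * f y); last first.
    by apply/funext => y; rewrite sub0r.
  apply: (is_derive_eq d2); rewrite /h; field; exact: lt0r_neq0.
have ck : continuous (fun z => h z * f z).
  move=> z; have d1 := is_derive_sub (is_derive_const 1 z) (is_derive_scale 2
    (is_derive_expn 2 (is_derive_inv (is_derive_1Dsqr z) (lt0r_neq0 (p z))))).
  exact: is_derive_continuous (is_derive_mul d1 (is_derive_gauss_density z)).
have h01 z : 1 <= z -> 0 <= h z <= 1.
  move=> z1; have e : (1 + z ^+ 2)^-1 <= 2^-1 by rewrite lef_pV2 ?posrE//; nra.
  have e0 : 0 < (1 + z ^+ 2)^-1 by rewrite invr_gt0.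
  rewrite /h; nra.
have k0 z : x <= z -> 0 <= h z * f z.
  move=> xz; have /andP[h0 _] := h01 z (le_trans x1 xz).
  by rewrite mulr_ge0// ltW// gauss_density_gt0.
have Foo : - (z / (1 + z ^+ 2) * f z) @[z --> +oo] --> 0.
  rewrite -oppr0; apply: cvgN; apply: gauss_density_cvg0.
  near=> z; have z0 : 0 < z by near: z; apply: nbhs_pinfty_gt; exact: num_real.
  apply/andP; split; first by rewrite divr_ge0// ltW.
  by rewrite ler_pdivrMr// ler_peMr ?lerDl ?sqr_ge0// ltW.
have := integral_tail_FTC dF ck k0 Foo; rewrite opprK -lee_fin => <-.
rewrite gauss_tailE; apply: ge0_le_integral => //=.
- by move=> z; rewrite ?in_itv/= ?andbT => /k0; rewrite lee_fin.
- by apply/measurable_funTS/measurable_EFinP; exact (continuous_measurable_fun ck).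
- by apply/measurable_funTS/measurable_EFinP; exact measurable_gauss_density.
- move=> z; rewrite ?in_itv/= ?andbT lee_fin => xz.
  have /andP[_ h1] := h01 z (le_trans x1 xz).
  by rewrite ler_piMl// ltW// gauss_density_gt0.
Unshelve. all: by end_near. Qed.

Lemma inv_mills_gt0 u : 0 < A u.
Proof. by rewrite inv_millsE divr_gt0 ?gauss_density_gt0// gauss_tail_gt0. Qed.

Lemma inv_mills_ge u : u <= A u.
Proof.
have [u0|u0] := leP u 0; first exact: le_trans u0 (ltW (inv_mills_gt0 u)).
by rewrite inv_millsE ler_pdivlMr ?gauss_tail_gt0// gauss_tail_ub// ltW.
Qed.

Lemma inv_mills_le u : 1 <= u -> A u <= u + u^-1.
Proof.
move=> u1; rewrite inv_millsE ler_pdivrMr ?gauss_tail_gt0//.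
have u0 : 0 < u by lra.
have p : 0 < 1 + u ^+ 2 by rewrite ltr_pwDl// sqr_ge0.
have k : 0 < u / (1 + u ^+ 2) by rewrite divr_gt0.
rewrite -(ler_pM2l k); apply: le_trans (gauss_tail_lb u1) _.
rewrite le_eqVlt; apply/orP; left; apply/eqP; field.
by rewrite !gt_eqF.
Qed.

Lemma is_derive_inv_mills u : is_derive u 1 A (A u * (A u - u)).
Proof.
have N0 : N u != 0 by rewrite gt_eqF// gauss_tail_gt0.
have d := is_derive_mul (is_derive_gauss_density u) (is_derive_inv (is_derive_gauss_tail u) N0).
have -> : A = fun y => f y * (N y)^-1 by apply/funext => y; rewrite inv_millsE.
by apply: (is_derive_eq d); field.
Qed.

Lemma is_derive_ln_gauss_tail u : is_derive u 1 (fun y => ln (N y)) (- A u).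
Proof.
apply: (is_derive_eq (is_derive_comp (is_derive_gauss_tail u) (is_derive1_ln (gauss_tail_gt0 u)))).
by rewrite inv_millsE mulrN mulrC.
Qed.

Lemma inv_mills_derive_ge0 u : 0 <= A u * (A u - u).
Proof. by rewrite mulr_ge0 ?(ltW (inv_mills_gt0 u))// subr_ge0 inv_mills_ge. Qed.

Lemma inv_mills_ndecr u v : u <= v -> A u <= A v.
Proof.
rewrite le_eqVlt => /predU1P[->//|uv].
have [c _ e] := MVT_is_derive uv (fun x _ => is_derive_inv_mills x).
by rewrite -subr_ge0 e mulr_ge0 ?inv_mills_derive_ge0// subr_ge0 ltW.
Qed.

Lemma ln_gauss_tail_le0 u : ln (N u) <= 0.
Proof. exact/ln_le0/gauss_tail_le1. Qed.

Lemma inv_mills_bounds : exists2 C : R, 1 <= C & forall u,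
  [/\ A u <= C * (1 + Num.max u 0), A u * (A u - u) <= C,
      A u * (A u - u) * `|u| <= C * (1 + Num.max u 0) &
      - (C * (1 + Num.max u 0 ^+ 2)) <= ln (N u)].
Proof.
set n := N 0; have n0 : 0 < n := gauss_tail_gt0 0.
have n1 : n <= 1 := gauss_tail_le1 0.
have ln0 : ln n <= 0 := ln_gauss_tail_le0 0.
have i1 : 1 <= n^-1 by rewrite invf_ge1.
have A1 : A 1 <= 2 by have := inv_mills_le (lexx 1); rewrite invr1; lra.
have Aneg u : u <= 0 -> A u * n <= f u.
  move=> u0; rewrite inv_millsE mulrAC ler_pdivrMr ?gauss_tail_gt0//.
  rewrite ler_pM2l ?gauss_density_gt0//.
  by move: u0; rewrite le_eqVlt => /predU1P[->//|/gauss_tail_decr/ltW].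
exists (4 + 4 * n^-1 - ln n); first by lra.
move=> u; have A0 := inv_mills_gt0 u; have Au := inv_mills_ge u.
have [u0|u0] := leP u 0; last have [u1|u1] := leP 1 u.
- have h := Aneg u u0; have h2 := gauss_density_le u; have f0 := gauss_density_gt0 u.
  have fu2 : f u * u ^+ 2 <= 2 by nra.
  have fu : f u * - u <= 1 by nra.
  have f1 : f u <= 1 by nra.
  have a1 : A u <= 2 by apply: le_trans A1; apply: inv_mills_ndecr; lra.
  have b1 : A u * - u <= n^-1.
    rewrite -[leRHS]mul1r ler_pdivlMr//; nra.
  have b2 : A u * u ^+ 2 <= 2 * n^-1.
    rewrite ler_pdivlMr//; have := sqr_ge0 u; nra.
  rewrite ler0_norm// expr0n/= addr0 mulr1; split.
  + lra.
  + have : A u * (A u - u) = A u * A u + A u * - u by ring.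
    nra.
  + have : A u * (A u - u) * - u = A u * (A u * - u) + A u * u ^+ 2 by ring.
    nra.
  + have : ln n <= ln (N u).
      rewrite ler_ln ?posrE ?gauss_tail_gt0//.
      by move: u0; rewrite le_eqVlt => /predU1P[->//|/gauss_tail_decr/ltW].
    lra.
(* Both remaining cases have u > 0: the slope of ln N on [0, u] is - A, and A is nondecreasing. *)
all: have hln : ln n - A u * u <= ln (N u) by (
  have [c /andP[c0 cu]] := MVT_is_derive u0 (fun x _ => is_derive_ln_gauss_tail x);
  rewrite subr0 -/n => e; have := inv_mills_ndecr (ltW cu); nra).
- have a1 := inv_mills_le u1.
  have v0 : 0 < u^-1 by rewrite invr_gt0.
  have v1 : u^-1 <= 1 by rewrite invf_le1.
  have uv : u * u^-1 = 1 by rewrite mulfV// gt_eqF.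
  have b1 : A u * (A u - u) <= 2 by nra.
  rewrite (gtr0_norm u0); split; nra.
- have a1 : A u <= 2 by apply: le_trans A1; apply: inv_mills_ndecr; exact: ltW.
  have b1 : A u * (A u - u) <= 4 by nra.
  rewrite (gtr0_norm u0); split; nra.
Qed.

End mills_ratio.

(** * Densities, independence and integration by parts *)

Section density.
Local Open Scope ereal_scope.

(** The change of variables holds for the Radon-Nikodym derivative of nu; [w] agrees with it almost
    everywhere, having the same integral over every measurable set. *)
Lemma ge0_integral_density d (T : measurableType d) (R : realType)
    (nu : {finite_measure set T -> \bar R})
    (mu : {sigma_finite_measure set T -> \bar R}) (w : T -> \bar R) :
  measurable_fun setT w -> (forall x, 0 <= w x) ->
  (forall A, measurable A -> nu A = \int[mu]_(x in A) w x) ->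
  forall k : T -> \bar R, measurable_fun setT k -> (forall x, 0 <= k x) ->
  \int[nu]_x k x = \int[mu]_x (k x * w x).
Proof.
move=> mw w0 nuE k mk k0.
have numu : nu `<< mu.
  apply/null_content_dominatesP => A mA A0; rewrite nuE//.
  exact/null_set_integral/A0/measurable_funTS.
rewrite -(Radon_Nikodym_SigmaFinite.change_of_variables numu k0 measurableT mk).
have mRN : measurable_fun setT (Radon_Nikodym_SigmaFinite.f nu mu).
  exact: measurable_int (Radon_Nikodym_SigmaFinite.f_integrable numu).
apply: ae_eq_integral => //; try exact: emeasurable_funM.
apply: ae_eqe_mul2l; apply: integral_ae_eq => //.
- exact: Radon_Nikodym_SigmaFinite.f_integrable.
- by move=> A _ mA; rewrite -Radon_Nikodym_SigmaFinite.f_integral// nuE.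
Qed.

Context d (T : measurableType d) (R : realType) (P : probability T R).
Local Notation mu := (@lebesgue_measure R).

Definition has_density (X : T -> R) (w : R -> R) :=
  forall A : set R, measurable A -> P (X @^-1` A) = \int[mu]_(x in A) (w x)%:E.

Context (X : {RV P >-> R}) (w : R -> R).
Hypotheses (mw : measurable_fun setT w) (w_ge0 : forall x, (0 <= w x)%R).
Hypothesis Xw : has_density X w.

Lemma ge0_integral_RV (k : R -> \bar R) : measurable_fun setT k ->
  (forall x, 0 <= k x) -> \int[P]_t k (X t) = \int[mu]_x (k x * (w x)%:E).
Proof.
move=> mk k0.
(* Lebesgue measure lives on [measurableTypeR R], whose measurable structure is
   only convertible to the default one on [R]. *)
have mX : measurable_fun setT (X : T -> measurableTypeR R).
  exact (@measurable_funPT _ _ _ _ X).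
pose X' : {mfun T >-> measurableTypeR R} :=
  @mfun_Sub _ _ T (measurableTypeR R) X (mem_set mX).
rewrite -(@ge0_integral_density _ _ _ (distribution P X') mu (EFin \o w)) //.
- rewrite ge0_integral_distribution//.
by apply/measurable_EFinP; exact mw.
Qed.

Lemma integrable_RV (K : R -> R) : measurable_fun setT K ->
  mu.-integrable setT (fun x => (K x * w x)%:E) ->
  P.-integrable setT (fun t => (K (X t))%:E) /\
  \int[P]_t (K (X t))%:E = \int[mu]_x (K x * w x)%:E.
Proof.
move=> mK iK.
have mKE : measurable_fun setT (EFin \o K) by exact/measurable_EFinP.
have mX : measurable_fun setT X by [].
have habs : \int[P]_t `|(K (X t))%:E| = \int[mu]_x `|(K x * w x)%:E|.
  rewrite (@ge0_integral_RV (fun x => `|(K x)%:E|))//; last exact: measurableT_comp.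
  by apply: eq_integral => x _; rewrite -EFinM /= normrM (ger0_norm (w_ge0 x)).
split.
  apply/integrableP; split.
    by apply/measurable_EFinP; exact: measurableT_comp.
  by rewrite habs; have /integrableP[] := iK.
rewrite [LHS]integralE [RHS]integralE.
congr (_ - _).
  rewrite (eq_integral (fun t => (EFin \o K)^\+ (X t))); last first.
    by move=> t _; rewrite !funeposE.
  rewrite ge0_integral_RV//; last exact: measurable_funepos.
  by apply: eq_integral => x _; rewrite !funeposE /= maxe_pMl ?lee_fin// mul0e.
rewrite (eq_integral (fun t => (EFin \o K)^\- (X t))); last first.
  by move=> t _; rewrite !funenegE.
rewrite ge0_integral_RV//; last exact: measurable_funeneg.
by apply: eq_integral => x _; rewrite !funenegE /= maxe_pMl ?lee_fin// mul0e -EFinM mulNr.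
Qed.

End density.

(** * The logistic function and the law of the product Y G *)

Section logistic.
Context {R : realType}.
Implicit Types x : R.

Lemma logistic_den_gt0 x : 0 < 1 + expR (- x).
Proof. by rewrite addr_gt0// expR_gt0. Qed.

Lemma logistic_gt0 x : 0 < logistic x.
Proof. by rewrite invr_gt0 logistic_den_gt0. Qed.

Lemma logistic_le1 x : logistic x <= 1.
Proof. by rewrite invf_le1 ?logistic_den_gt0// lerDl expR_ge0. Qed.

Lemma logisticN x : logistic (- x) = 1 - logistic x.
Proof.
rewrite /logistic opprK expRN; have e0 := expR_gt0 x; set e := expR x in e0 *.
by field; rewrite ?gt_eqF//=; lra.
Qed.

Lemma is_derive_logistic x : is_derive x 1 logistic (logistic x * logistic (- x)).
Proof.
have d := is_derive_comp (is_derive_scale (-1) (is_derive_var x)) (is_derive_expR _).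
have e (y : R) : 1 + expR (-1 * y) != 0 by rewrite gt_eqF// addr_gt0 ?expR_gt0.
have := is_derive_inv (is_derive_add (is_derive_const 1 x) d) (e x).
rewrite (_ : (fun y => _^-1) = logistic); last first.
  by apply/funext => y; rewrite /logistic mulN1r.
move=> d'; apply: (is_derive_eq d'); rewrite logisticN /logistic mulN1r.
by field; rewrite gt_eqF// addr_gt0 ?expR_gt0.
Qed.

Lemma measurable_logistic : measurable_fun setT (@logistic R).
Proof.
apply: continuous_measurable_fun => x; exact: is_derive_continuous (is_derive_logistic x).
Qed.

End logistic.

(** The density of S when l = sqrt lambda. At l = 0 the logistic factor is 1/2 and the Gaussian
    density remains, so Z is covered by the same lemmas. *)
Definition tilted_density {R : realType} (l s : R) : R :=
  2 * logistic (l * s) * gauss_density s.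

Section laws.
Context d (T : measurableType d) (R : realType) (P : probability T R).
Local Notation mu := (@lebesgue_measure R).
Implicit Types l s : R.

Lemma tilted_density_ge0 l s : 0 <= tilted_density l s.
Proof. by rewrite !mulr_ge0// ltW// ?logistic_gt0// gauss_density_gt0. Qed.

Lemma tilted_density_le l s : tilted_density l s <= 2 * gauss_density s.
Proof.
by rewrite ler_pM2r ?gauss_density_gt0// ler_piMr// logistic_le1.
Qed.

Lemma tilted_density0 : tilted_density 0 = @gauss_density R.
Proof. by apply/funext => s; rewrite /tilted_density mul0r /logistic oppr0 expR0; field. Qed.

Lemma is_derive_tilted_density l s : is_derive s 1 (tilted_density l)
  ((l * logistic (- (l * s)) - s) * tilted_density l s).
Proof.
have d1 := is_derive_comp (is_derive_scale l (is_derive_var s)) (is_derive_logistic _).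
have := is_derive_mul (is_derive_scale 2 d1) (is_derive_gauss_density s).
by move=> d2; apply: (is_derive_eq d2); rewrite /tilted_density; ring.
Qed.

Lemma measurable_tilted_density l : measurable_fun setT (tilted_density l).
Proof.
apply: continuous_measurable_fun => x; exact: is_derive_continuous (is_derive_tilted_density l x).
Qed.

Lemma has_density_normal (Z : T -> R) : has_law P Z (normal_prob 0 1) ->
  has_density P Z (tilted_density 0).
Proof. by move=> hZ A mA; rewrite hZ// tilted_density0 /normal_prob gauss_densityE. Qed.

Lemma ge0_integral_lebesgueN (q : R -> \bar R) (A : set R) :
  measurable A -> measurable_fun setT q -> (forall x, (0 <= q x)%E) ->
  (\int[mu]_(x in -%R @^-1` A) q (- x)%R = \int[mu]_(x in A) q x)%E.
Proof.
move=> mA mq q0.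
transitivity (\int[pushforward mu (-%R : R -> measurableTypeR R)]_(x in A) q x)%E.
  rewrite ge0_integral_pushforward//; exact: measurable_funTS.
by apply: eq_measure_integral => //= B mB _; exact: lebesgue_measureN.
Qed.

Lemma rademacher_probE (p : R) (B : set R) : 0 <= p <= 1 ->
  rademacher_prob p B = (p * \1_B 1 + (1 - p) * \1_B (- 1))%:E.
Proof. by move=> p01; rewrite /rademacher_prob /pushforward bernoulli_probE. Qed.

(** On Y = 1 the event reads G in A, on Y = -1 it reads - G in A. Reflection turns 1 - logistic(l g)
    into logistic(l g), so both events have the same mass, whence the factor 2. *)
Lemma has_density_tilted l (G Y : {RV P >-> R}) :
  has_law P G (normal_prob 0 1) ->
  has_cond_law P Y G (fun g => rademacher_prob (logistic (l * g))) ->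
  has_density P (fun w => Y w * G w) (tilted_density l).
Proof.
move=> hG hY A mA.
have N11 : (1 : R) <> -1 by lra.
have dG := has_density_normal hG.
have p01 (g : R) : 0 <= logistic (l * g) <= 1 by rewrite ltW ?logistic_gt0 ?logistic_le1.
have mY : measurable_fun setT Y by [].
have mG : measurable_fun setT G by [].
have mS : measurable_fun setT (fun w => Y w * G w) by exact: measurable_funM.
have mSA : measurable ((fun w => Y w * G w) @^-1` A).
  by rewrite -[X in measurable X]setTI; exact: mS.
have mYB B : measurable B -> measurable (Y @^-1` B).
  by move=> mB; rewrite -[X in measurable X]setTI; exact: mY.
have mL : measurable_fun setT (fun g : R => logistic (l * g)).
  by apply: measurableT_comp; [exact: measurable_logistic|exact: measurable_funM].
pose q x := logistic (l * x) * gauss_density x.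
have mq : measurable_fun setT q.
  by apply: measurable_funM => //; exact: measurable_gauss_density.
have q0 x : 0 <= q x by rewrite mulr_ge0// ltW// ?logistic_gt0// gauss_density_gt0.
have ek (k : R -> R) (B : set R) : measurable B -> measurable_fun setT k ->
    (forall x, 0 <= k x) -> (\int[P]_(w in G @^-1` B) (k (G w))%:E =
      \int[mu]_(x in B) (k x * gauss_density x)%:E)%E.
  move=> mB mk k0; rewrite integral_mkcond.
  rewrite (eq_integral (fun w => ((EFin \o k) \_ B) (G w))); last first.
    by move=> w _; rewrite !patchE; congr (if _ then _ else _); apply/idP/idP; rewrite !in_setE.
  rewrite (ge0_integral_RV (measurable_tilted_density 0) (tilted_density_ge0 0) dG).
  - rewrite [RHS]integral_mkcond; apply: eq_integral => x _; rewrite !patchE.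
    by case: ifP => _; rewrite ?mul0e// tilted_density0 EFinM.
  - by apply/(measurable_restrictT _ mB)/measurable_funTS/measurable_EFinP.
  - by move=> x; rewrite patchE; case: ifP => // _; rewrite lee_fin.
pose E1 := G @^-1` A `&` Y @^-1` [set 1].
pose E2 := G @^-1` (-%R @^-1` A) `&` Y @^-1` [set -1].
have mA' : measurable (-%R @^-1` A : set R).
  have mN : measurable_fun setT (fun x : R => - x).
    by apply: continuous_measurable_fun => x; exact: opp_continuous.
  by rewrite -[X in measurable X]setTI; exact: mN.
have PE1 : P E1 = (\int[mu]_(x in A) (q x)%:E)%E.
  rewrite hY// (eq_integral (fun w => (logistic (l * G w))%:E)).
    by apply: (ek (fun g => logistic (l * g))) => // x; rewrite ltW ?logistic_gt0.
  by move=> w _; rewrite rademacher_probE// !indicE mem_set// memNset/= ?mulr1 ?mulr0 ?addr0//; lra.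
have PE2 : P E2 = (\int[mu]_(x in A) (q x)%:E)%E.
  rewrite hY// (eq_integral (fun w => (1 - logistic (l * G w))%:E)); last first.
    by move=> w _; rewrite rademacher_probE// !indicE memNset ?mem_set//= ?mulr1 ?mulr0 ?add0r//; lra.
  rewrite (ek (fun g => 1 - logistic (l * g)))//.
  - rewrite -(@ge0_integral_lebesgueN (EFin \o q))//.
    + apply: eq_integral => x _; rewrite /q /= mulrN logisticN /gauss_density.
      by rewrite sqrrN.
    + exact/measurable_EFinP.
  - exact: measurable_funB.
  - by move=> x; rewrite subr_ge0 logistic_le1.
(* Y is an arbitrary real random variable; that it takes the values 1 and -1 almost surely is read
   off the kernel. *)
have P3 : P (Y @^-1` (~` [set 1; -1])) = 0%E.
  have := hY setT (~` [set 1; -1]) measurableT.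
  rewrite preimage_setT setTI => -> //; last first.
    by apply: measurableC; apply: measurableU.
  apply: integral0_eq => w _; rewrite rademacher_probE// !indicE !memNset /= ?mulr0 ?addr0//.
    by move=> h; apply: h; right.
  by move=> h; apply: h; left.
have E12 : E1 `&` E2 = set0.
  rewrite -subset0 => w [[_ /= y1] [_ /=]]; rewrite y1; exact: N11.
have mE1 : measurable E1.
  apply: measurableI; last exact: mYB.
  by rewrite -[X in measurable X]setTI; exact: mG.
have mE2 : measurable E2.
  apply: measurableI; last exact: mYB.
  by rewrite -[X in measurable X]setTI; exact: mG.
have m3 : measurable (Y @^-1` (~` [set 1; -1])).
  by apply: mYB; apply: measurableC; apply: measurableU.
have PE12 : P (E1 `|` E2) = (\int[mu]_(x in A) (tilted_density l x)%:E)%E.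
  rewrite measureU//; transitivity (\int[mu]_(x in A) (q x)%:E + \int[mu]_(x in A) (q x)%:E)%E.
    by congr (_ + _)%E; [exact: PE1|exact: PE2].
  rewrite -ge0_integralD//.
  - by apply: eq_integral => x _; rewrite -EFinD /q /tilted_density; congr EFin; ring.
  - by move=> x _; rewrite lee_fin.
  - by apply/measurable_funTS/measurable_EFinP; exact mq.
  - by move=> x _; rewrite lee_fin.
  - by apply/measurable_funTS/measurable_EFinP; exact mq.
rewrite -PE12; apply/eqP; rewrite eq_le; apply/andP; split.
  rewrite -[leRHS]adde0 -P3.
  apply: (le_trans _ (measureU2 _ (measurableU _ _ mE1 mE2) m3)).
  apply: le_measure; rewrite ?inE//; first by apply: measurableU => //; exact: measurableU.
  move=> w /= Aw; have [y1|y1] := eqVneq (Y w) 1.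
    by left; left; split => //=; move: Aw; rewrite y1 mul1r.
  have [y2|y2] := eqVneq (Y w) (-1).
    by left; right; split => //=; move: Aw; rewrite y2 mulN1r.
  by right => /= -[] /eqP; [rewrite (negbTE y1)|rewrite (negbTE y2)].
apply: le_measure; rewrite ?inE//; first exact: measurableU.
move=> w /= [[Aw /= y1]|[Aw /= y2]]; first by rewrite y1 mul1r.
by rewrite y2 mulN1r.
Qed.

End laws.

Lemma integrable_dominated d (T : measurableType d) (R : realType)
    (m : {measure set T -> \bar R}) (f g : T -> R) :
  measurable_fun setT f -> (forall t, `|f t| <= g t) ->
  m.-integrable setT (fun t => (g t)%:E) -> m.-integrable setT (fun t => (f t)%:E).
Proof.
move=> mf fg; apply: le_integrable => //; first exact/measurable_EFinP.
by move=> t _; rewrite lee_fin (le_trans (fg t))// ler_norm.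
Qed.

Section gaussian_moments.
Context {R : realType}.
Local Notation mu := (@lebesgue_measure R).
Local Notation f := (@gauss_density R).

(** Half of the exponent pays for the polynomial, by 1 + s^2 <= 4 exp (s^2 / 4); the other half, exp
    (- s^2 / 4), is the normal density of variance 2 up to a factor, and its total mass is known. *)
Lemma gauss_density_sqr_dominated :
  exists2 c : R, 0 < c & forall s, (1 + s ^+ 2) * f s <= c * normal_pdf 0 (Num.sqrt 2) s.
Proof.
have s20 : Num.sqrt 2 != 0 :> R by rewrite gt_eqF// sqrtr_gt0.
have p0 := normal_peak_gt0 s20; have q0 : 0 < Num.sqrt (2 * pi) :> R.
  by rewrite sqrtr_gt0 mulr_gt0// pi_gt0.
exists (4 / (Num.sqrt (2 * pi) * normal_peak (Num.sqrt 2))).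
  by rewrite divr_gt0// mulr_gt0.
move=> s; rewrite normal_pdfE//= /normal_fun subr0 sqr_sqrtr//.
have -> : - s ^+ 2 / (2 *+ 2) = - (s ^+ 2 / 4).
  by rewrite mulNr; congr (- (_ / _)); ring.
have e1 := expR_ge1Dx (s ^+ 2 / 4).
rewrite /gauss_density (_ : s ^+ 2 / 2 = s ^+ 2 / 4 + s ^+ 2 / 4); last by field.
rewrite opprD expRD expRN; set e := expR _ in e1 *.
have e0 : 0 < e by rewrite /e expR_gt0.
rewrite [leRHS](_ : _ = 4 / (Num.sqrt (2 * pi) * e)); last first.
  by field; rewrite !gt_eqF.
rewrite [leLHS](_ : _ = (1 + s ^+ 2) / e / (Num.sqrt (2 * pi) * e)); last first.
  by field; rewrite !gt_eqF.
rewrite ler_pM2r ?invr_gt0 ?mulr_gt0// ler_pdivrMr//; nra.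
Qed.

Lemma integrable_sqr_gauss :
  mu.-integrable setT (fun s => ((1 + s ^+ 2) * f s)%:E).
Proof.
have [c c0 h] := gauss_density_sqr_dominated.
apply: (@integrable_dominated _ (measurableTypeR R) _ mu _
  (fun s => c * normal_pdf 0 (Num.sqrt 2) s)).
- exact (continuous_measurable_fun (fun s => is_derive_continuous
    (is_derive_mul (is_derive_1Dsqr s) (is_derive_gauss_density s)))).
- move=> s; rewrite ger0_norm//.
  by rewrite mulr_ge0 ?addr_ge0 ?sqr_ge0// ltW// gauss_density_gt0.
- under eq_fun do rewrite EFinM.
  by apply: integrableZl => //; exact: integrable_normal_pdf.
Qed.

End gaussian_moments.

(** * Integration by parts against the tilted density *)

Section stein.
Context {R : realType}.
Local Notation mu := (@lebesgue_measure R).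
Local Notation f := (@gauss_density R).
Implicit Types s : R.
Variables (l C : R) (h dh : R -> R).
Hypotheses (hdh : forall s : R, is_derive s 1 h (dh s)) (cdh : continuous dh).
Hypothesis h_le : forall s, `|h s| <= C * (1 + `|s|).
Hypothesis dh_le : forall s, `|dh s| <= C.

Let k (s : R) : R := h s * tilted_density l s.
Let dk (s : R) : R := h s * ((l * logistic (- (l * s)) - s) * tilted_density l s)
  + tilted_density l s * dh s.

Let kdk s : is_derive s 1 k (dk s).
Proof. exact: is_derive_mul (hdh s) (is_derive_tilted_density l s). Qed.

Let C0 : 0 <= C. Proof. exact: le_trans (normr_ge0 _) (dh_le 0). Qed.

Let cdk : continuous dk.
Proof.
have cw : continuous (tilted_density l).
  by move=> s; exact: is_derive_continuous (is_derive_tilted_density l s).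
have ch : continuous h by move=> s; exact: is_derive_continuous (hdh s).
have cl : continuous (fun s : R => l * logistic (- (l * s)) - s).
  move=> s; have d := is_derive_scale (- l) (is_derive_var s).
  have d1 := is_derive_scale l (is_derive_comp d (is_derive_logistic _)).
  rewrite (_ : (fun s => _) = fun s => l * logistic (- l * s) - s).
    exact: is_derive_continuous (is_derive_sub d1 (is_derive_var s)).
  by apply/funext => y; rewrite mulNr.
by move=> s; apply: cvgD; apply: cvgM; [exact: ch|apply: cvgM;
  [exact: cl|exact: cw]|exact: cw|exact: cdh].
Qed.

Let K := C * (2 + `|l|) * 4.

Let dk_le s : `|dk s| <= K * ((1 + s ^+ 2) * f s).
Proof.
have f0 := gauss_density_gt0 s; have w0 := tilted_density_ge0 l s.
have w1 := tilted_density_le l s.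
have -> : dk s = (h s * (l * logistic (- (l * s)) - s) + dh s) * tilted_density l s.
  by rewrite /dk; ring.
rewrite normrM (ger0_norm w0).
have n1 : `|l * logistic (- (l * s)) - s| <= `|l| + `|s|.
  apply: le_trans (ler_normB _ _) _; rewrite lerD2r normrM ler_piMr//.
  by rewrite gtr0_norm ?logistic_gt0// logistic_le1.
have n2 : `|h s * (l * logistic (- (l * s)) - s) + dh s| <=
    C * (1 + `|s|) * (`|l| + `|s|) + C.
  apply: le_trans (ler_normD _ _) _; apply: lerD => //; rewrite normrM.
  exact: ler_pM.
have s2 : `|s| ^+ 2 = s ^+ 2 by rewrite real_normK ?num_real.
have n3 : C * (1 + `|s|) * (`|l| + `|s|) + C <= C * (2 + `|l|) * 2 * (1 + s ^+ 2).
  have -> : C * (1 + `|s|) * (`|l| + `|s|) + C = C * ((1 + `|s|) * (`|l| + `|s|) + 1) by ring.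
  rewrite -!mulrA ler_wpM2l// -s2.
  have := normr_ge0 s; have := normr_ge0 l; have := sqr_ge0 (`|s| - 1); nra.
apply: le_trans (_ : C * (2 + `|l|) * 2 * (1 + s ^+ 2) * (2 * f s) <= _).
  by apply: ler_pM => //; exact: le_trans n2 n3.
by rewrite le_eqVlt; apply/orP; left; apply/eqP; rewrite /K; ring.
Qed.

Let integrable_dk : mu.-integrable setT (EFin \o dk).
Proof.
apply: (@integrable_dominated _ (measurableTypeR R) _ mu _
  (fun s => K * ((1 + s ^+ 2) * f s))).
- exact (continuous_measurable_fun cdk).
- exact: dk_le.
- under eq_fun do rewrite EFinM.
  by apply: integrableZl => //; exact: integrable_sqr_gauss.
Qed.

Let k_le s : 0 < s -> `|k s| <= C * 8 / s /\ `|k (- s)| <= C * 8 / s.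
Proof.
move=> s0.
have aux t : `|t| = s -> `|k t| <= C * 8 / s.
  move=> ts; rewrite /k normrM (ger0_norm (tilted_density_ge0 l t)) ler_pdivlMr//.
  have f0 := gauss_density_gt0 t; have w1 := tilted_density_le l t.
  have w0 := tilted_density_ge0 l t.
  have h1 := h_le t; rewrite ts in h1; have fl := gauss_density_le t.
  have t2 : t ^+ 2 = s ^+ 2 by rewrite -ts real_normK ?num_real.
  rewrite t2 in fl.
  apply: le_trans (_ : C * (1 + s) * (2 * f t) * s <= _).
    by rewrite ler_pM2r//; apply: ler_pM.
  have -> : C * (1 + s) * (2 * f t) * s = C * ((1 + s) * (2 * f t) * s) by ring.
  rewrite ler_wpM2l//; have := sqr_ge0 (s - 1); nra.
by split; apply: aux; rewrite ?normrN gtr0_norm.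
Qed.

(** By dominated convergence this is the limit of the integrals over symmetric intervals, which are
    boundary terms of order 1/n by [k_le]. Using [n.+1] keeps the intervals nondegenerate and the
    bound free of division by 0. *)
Let integral_dk : (\int[mu]_s (dk s)%:E = 0)%E.
Proof.
pose F n s := ((EFin \o dk) \_ `[- (n.+1%:R), n.+1%:R]) s.
have mdk : measurable_fun setT (EFin \o dk : measurableTypeR R -> \bar R).
  by apply/measurable_EFinP; exact (continuous_measurable_fun cdk).
have mF n : measurable_fun setT (F n : measurableTypeR R -> \bar R).
  by apply/(measurable_restrictT _ (measurable_itv _)); exact: measurable_funTS.
have [||_ _ cF] := @dominated_convergence _ _ _ mu _ measurableT F (EFin \o dk)
  (abse \o (EFin \o dk)) mF mdk _ (integrable_abse integrable_dk) _.
- apply/aeW => s _; apply: cvg_near_cst; near=> n.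
  rewrite /F patchE mem_set//= in_itv/= -ler_norml.
  near: n; have := nbhs_infty_ger `|s|; apply: filterS => n sn.
  by rewrite (le_trans sn)// ler_nat.
- apply/aeW => s n _; rewrite /F patchE; case: ifP => _ //=.
  by rewrite normr0 lee_fin.
have EF n : (\int[mu]_s F n s = (k n.+1%:R - k (- n.+1%:R))%:E)%E.
  rewrite /F -integral_mkcond (@continuous_FTC2 _ dk k)//.
  - by rewrite ltrNl -subr_gt0 opprK addr_gt0// ltr0n.
  - exact: continuous_subspaceT.
  - split.
    + by move=> s _; have [] := kdk s.
    + exact: cvg_at_right_filter (is_derive_continuous (kdk _)).
    + exact: cvg_at_left_filter (is_derive_continuous (kdk _)).
  - by move=> s _; rewrite derive1E; have [_] := kdk s.
have c0 : (k n.+1%:R - k (- n.+1%:R)) @[n --> \oo] --> (0 : R).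
  apply: norm_cvg0.
  apply: (@squeeze_cvgr _ _ _ _ (fun=> 0) (fun n => C * 16 * harmonic n)).
  - apply: nearW => n; rewrite normr_ge0/=.
    have n0 : 0 < n.+1%:R :> R by rewrite ltr0n.
    have [h1 h2] := k_le n0; apply: le_trans (ler_normB _ _) _.
    apply: le_trans (lerD h1 h2) _; rewrite le_eqVlt; apply/orP; left; apply/eqP.
    by rewrite /harmonic /=; ring.
  - exact: cvg_cst.
  - by rewrite -[X in _ --> X](mulr0 (C * 16)); apply: cvgM; [exact: cvg_cst|exact: cvg_harmonic].
have cE : (\int[mu]_s F n s)%E @[n --> \oo] --> 0%:E.
  rewrite (_ : (fun n => _) = EFin \o (fun n => k n.+1%:R - k (- n.+1%:R))).
    by apply: cvg_EFin => //; exact: nearW.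
  by apply/funext => n; exact: EF.
exact: (cvg_unique _ cF cE).
Unshelve. all: by end_near. Qed.

(** The logarithmic derivative of the density is l logistic(- l s) - s, so the integrand is minus
    the derivative of h times the density. *)
Lemma stein_tilted :
  mu.-integrable setT (fun s =>
    ((s * h s - dh s - l * logistic (- (l * s)) * h s) * tilted_density l s)%:E) /\
  (\int[mu]_s ((s * h s - dh s - l * logistic (- (l * s)) * h s)
     * tilted_density l s)%:E = 0)%E.
Proof.
rewrite (_ : (fun s => _) = (fun s => - (dk s)%:E)%E); last first.
  by apply/funext => s; rewrite -EFinN /dk; congr EFin; ring.
split; first exact: integrableN integrable_dk.
rewrite integralN ?integral_dk ?oppe0//.
by apply: integrable_add_def => //; exact: integrable_dk.
Qed.

End stein.

Section independence.
Context d (T : measurableType d) (R : realType) (P : probability T R).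

(** Independence makes the law of the pair a product, and Fubini integrates over X first with V
    frozen. It carries the one-variable Stein identity to margins that depend on both variables. *)
Lemma integral_indep_slice (X V : {RV P >-> R}) (K : R * R -> R) :
  independent_RVs P X V -> measurable_fun setT K ->
  P.-integrable setT (fun t => (K (X t, V t))%:E) ->
  (forall v, P.-integrable setT (fun t => (K (X t, v))%:E)) ->
  (forall v, \int[P]_t (K (X t, v))%:E = 0)%E ->
  (\int[P]_t (K (X t, V t))%:E = 0)%E.
Proof.
move=> XV mK iK iKv Kv0.
have mXV : measurable_fun setT (fun t => (X t, V t)) by exact: measurable_fun_pair.
pose W : {RV P >-> (R * R)%type} := mfun_Sub (mem_set mXV).
have mKE : measurable_fun setT (EFin \o K) by exact/measurable_EFinP.
have WE A : measurable A -> distribution P W A = (distribution P X \x distribution P V)%E A.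
  move=> mA; apply/esym.
  apply: (product_measure_unique (m' := distribution P W)) => //.
rewrite -[LHS](@integral_distribution _ _ _ _ _ P W (EFin \o K))//.
rewrite (eq_measure_integral (distribution P X \x distribution P V)%E); last first.
  by move=> A mA _; exact: WE.
rewrite -integral21_prod_meas1.
  apply: integral0_eq => v _; rewrite /fubini_G.
  rewrite -[RHS](Kv0 v) (@integral_distribution _ _ _ _ _ P X (fun x => (K (x, v))%:E))//;
    last exact: iKv.
  apply/measurable_EFinP; exact: (measurableT_comp mK (measurable_pair2 v)).
apply/integrableP; split => //.
rewrite (eq_measure_integral (distribution P W)); last by move=> A mA _; exact/esym/WE.
rewrite ge0_integral_distribution//; last exact: measurableT_comp.
by have /integrableP[] := iK.
Qed.

End independence.

(** * The expectations as functions of the coordinates *)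

Section real_expectation.
Context d (T : measurableType d) (R : realType) (P : probability T R).
Implicit Types f g : T -> R.

Definition integrableR f := P.-integrable setT (fun t => (f t)%:E).

Lemma integrableR_measurable f : integrableR f -> measurable_fun setT f.
Proof. by move=> /integrableP[/measurable_EFinP]. Qed.

Lemma integrableR_add f g : integrableR f -> integrableR g ->
  integrableR (fun t => f t + g t).
Proof. by move=> hf hg; rewrite /integrableR; under eq_fun do rewrite EFinD;
  exact: integrableD. Qed.

Lemma integrableR_sub f g : integrableR f -> integrableR g ->
  integrableR (fun t => f t - g t).
Proof. by move=> hf hg; rewrite /integrableR; under eq_fun do rewrite EFinB;
  exact: integrableB. Qed.

Lemma integrableR_scale c f : integrableR f -> integrableR (fun t => c * f t).
Proof. by move=> hf; rewrite /integrableR; under eq_fun do rewrite EFinM; exact: integrableZl. Qed.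

Lemma integrableR_cst c : integrableR (fun=> c).
Proof. exact: finite_measure_integrable_cst. Qed.

Lemma integralR_cst c : \int[P]_t c = c :> R.
Proof. rewrite Rintegral_cst//. by rewrite [X in fine X]probability_setT mulr1. Qed.

Lemma integralR_le f g : integrableR f -> integrableR g -> (forall t, f t <= g t) ->
  \int[P]_t f t <= \int[P]_t g t.
Proof. by move=> hf hg fg; apply: le_Rintegral. Qed.

Lemma integralR_gt0 f : integrableR f -> (forall t, 0 < f t) -> 0 < \int[P]_t f t.
Proof.
move=> hf f0; rewrite lt_neqAle Rintegral_ge0 ?andbT; last by move=> t _; exact: ltW.
apply/eqP => e0.
have mf : measurable_fun setT (fun t => (f t)%:E).
  exact/measurable_EFinP/integrableR_measurable.
have : (\int[P]_t `|(f t)%:E| = 0)%E.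
  under eq_integral do rewrite gee0_abs ?lee_fin ?(ltW (f0 _))//.
  by rewrite -[LHS]fineK ?integrable_fin_num//; congr EFin; rewrite [RHS]e0.
move/(ae_eq_integral_abs P measurableT mf) => [N [mN N0 sub]].
have NT : N = setT.
  rewrite -subTset => t _; apply: sub => /= h; have := h I.
  by move=> [] f00; have := f0 t; rewrite f00 ltxx.
by have := probability_setT P; rewrite -NT N0 => -[] /esym/eqP; rewrite oner_eq0.
Qed.

(** The envelope is asked only near [x0], since the bounds on the slopes of ln N(u) grow with a and
    b. *)
Lemma is_derive_integralR (f df : R -> T -> R) (G : T -> R) (x0 : R) :
  (forall x, integrableR (f x)) ->
  (forall (x : R) t, is_derive x 1 (f ^~ t) (df x t)) ->
  integrableR G -> (forall t, 0 <= G t) ->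
  (forall x t, x0 - 1 < x < x0 + 1 -> `|df x t| <= G t) ->
  is_derive x0 1 (fun x => \int[P]_t f x t) (\int[P]_t df x0 t).
Proof.
move=> hf hd hG G0 dG.
have d1 x t : partial1of2 f x t = df x t.
  by rewrite partial1of2E; have [_] := hd x t.
have Ix0 : `]x0 - 1, x0 + 1[%classic x0 by rewrite /= in_itv/=; lra.
have hd' (x : R) t : `]x0 - 1, x0 + 1[%classic x -> setT t -> derivable (f ^~ t) x 1.
  by move=> _ _; have [] := hd x t.
have dG' x t : `]x0 - 1, x0 + 1[%classic x -> setT t -> `|partial1of2 f x t| <= G t.
  by rewrite /= in_itv/= d1 => hx _; exact: dG.
apply: DeriveDef.
  by apply: (derivable_under_integral measurableT Ix0 _ hd' G0 hG dG') => x _; exact: hf.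
rewrite -derive1E (differentiation_under_integral measurableT Ix0 _ hd' G0 hG dG').
  by apply: eq_Rintegral => t _; exact: d1.
by move=> x _; exact: hf.
Qed.

(** The reverse triangle inequality in L^2, obtained from Cauchy-Schwarz by expanding the square of
    f - g. *)
Lemma sqrt_second_moment_lip f g (r : R) :
  integrableR (fun t => f t ^+ 2) -> integrableR (fun t => g t ^+ 2) ->
  integrableR (fun t => f t * g t) -> 0 <= r ->
  0 < \int[P]_t (f t ^+ 2) -> 0 < \int[P]_t (g t ^+ 2) ->
  \int[P]_t ((f t - g t) ^+ 2) <= r ^+ 2 ->
  `|Num.sqrt (\int[P]_t (f t ^+ 2)) - Num.sqrt (\int[P]_t (g t ^+ 2))| <= r.
Proof.
move=> hf hg hfg r0 f0 g0 hr.
set x := Num.sqrt _; set y := Num.sqrt _.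
have x0 : 0 < x by rewrite sqrtr_gt0.
have y0 : 0 < y by rewrite sqrtr_gt0.
have ex : \int[P]_t (f t ^+ 2) = x ^+ 2 by rewrite sqr_sqrtr// ltW.
have ey : \int[P]_t (g t ^+ 2) = y ^+ 2 by rewrite sqr_sqrtr// ltW.
(* Cauchy-Schwarz, by AM-GM with the weights [y / x] and [x / y]. *)
have xy : \int[P]_t (f t * g t) <= x * y.
  have -> : x * y = \int[P]_t (y / x / 2 * f t ^+ 2 + x / y / 2 * g t ^+ 2).
    rewrite RintegralD//; [|exact: integrableR_scale..].
    rewrite !RintegralZl// ex ey; field.
    by rewrite !gt_eqF.
  apply: integralR_le => //; first by apply: integrableR_add; exact: integrableR_scale.
  move=> t; rewrite -subr_ge0.
  have -> : y / x / 2 * f t ^+ 2 + x / y / 2 * g t ^+ 2 - f t * g t =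
    (y * f t - x * g t) ^+ 2 / (2 * x * y) by field; rewrite !gt_eqF.
  by rewrite divr_ge0 ?sqr_ge0// !mulr_ge0// ltW.
have e : \int[P]_t ((f t - g t) ^+ 2) = x ^+ 2 + y ^+ 2 - 2 * \int[P]_t (f t * g t).
  rewrite -ex -ey -RintegralD// -RintegralZl// -RintegralB//.
  - by apply: eq_Rintegral => t _; ring.
  - exact: integrableR_add.
  - exact: integrableR_scale.
rewrite -(@ler_pXn2r _ 2)// ?nnegrE// real_normK ?num_real//.
apply: le_trans hr; rewrite e; lra.
Qed.

End real_expectation.

(** The order of the quantifiers matters: as the tilted density is at most twice the Gaussian one, c
    serves every l and every probability space. *)
Lemma second_moment_bound (R : realType) : exists2 c : R, 0 < c &
  forall d (T : measurableType d) (P : probability T R) (X : {RV P >-> R}) l,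
    has_density P X (tilted_density l) ->
    integrableR P (fun t => 1 + X t ^+ 2) /\ \int[P]_t (1 + X t ^+ 2) <= c.
Proof.
have [c c0 hc] := @gauss_density_sqr_dominated R; exists (2 * c); first by rewrite mulr_gt0.
move=> d T P X l hX.
pose mu := @lebesgue_measure R.
have s20 (s : R) : 0 <= 1 + s ^+ 2 by rewrite addr_ge0 ?sqr_ge0.
have hle (s : R) : (1 + s ^+ 2) * tilted_density l s <= 2 * c * normal_pdf 0 (Num.sqrt 2) s.
  apply: le_trans (_ : 2 * ((1 + s ^+ 2) * gauss_density s) <= _).
    by rewrite [leRHS]mulrCA ler_wpM2l// tilted_density_le.
  by rewrite -mulrA ler_pM2l.
have mk : measurable_fun setT (fun s : R => 1 + s ^+ 2).
  exact (continuous_measurable_fun (fun s => is_derive_continuous (is_derive_1Dsqr s))).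
have mw := measurable_tilted_density l.
have ipdf : mu.-integrable setT (fun s => (2 * c * normal_pdf 0 (Num.sqrt 2) s)%:E).
  under eq_fun do rewrite EFinM.
  by apply: integrableZl => //; exact: integrable_normal_pdf.
have ik : mu.-integrable setT (fun s => ((1 + s ^+ 2) * tilted_density l s)%:E).
  apply: (@integrable_dominated _ (measurableTypeR R) _ mu _ _ _ _ ipdf).
  - exact (measurable_funM mk mw).
  - by move=> s; rewrite ger0_norm ?hle// mulr_ge0// tilted_density_ge0.
have [i1 e1] := integrable_RV mw (tilted_density_ge0 l) hX mk ik.
split; first exact: i1.
rewrite /Rintegral e1 -[leRHS]/(fine (2 * c)%:E); apply: fine_le.
- exact: integrable_fin_num.
- by [].
- apply: le_trans (_ : \int[mu]_s (2 * c * normal_pdf 0 (Num.sqrt 2) s)%:E <= _)%E.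
    by apply: le_integral => // s _; rewrite lee_fin.
  under eq_integral do rewrite EFinM.
  rewrite integralZl//; last exact: integrable_normal_pdf.
  by rewrite integral_normal_pdf mule1.
Qed.

(** * The margin in the coordinates a and b *)

Section margin_calculus.
Context {R : realType} (kappa : R).
Implicit Types a b s z : R.
Local Notation A := (@inv_mills R).
Local Notation N := (@gauss_tail R).
Local Notation dA u := (A u * (A u - u)).

Definition margin_ab a b s z : R :=
  (kappa * Num.sqrt (1 + a ^+ 2) - a * s) * Num.sqrt (1 + b ^+ 2) - b * z.
Local Notation u := margin_ab.

(** The slope is written through u itself, so that A'(u) u appears, which is bounded for u <= 0, and
    so that A(u) u can be traded for A(u)^2 - A'(u). *)
Lemma is_derive_margin_b a b s z :
  is_derive b 1 (fun b' => u a b' s z) ((b * u a b s z - z) / (1 + b ^+ 2)).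
Proof.
have d := is_derive_sub (is_derive_scale (kappa * Num.sqrt (1 + a ^+ 2) - a * s)
  (is_derive_sqrt1Dsqr b)) (is_derive_mul (is_derive_var b) (is_derive_const z b)).
apply: (is_derive_eq d); rewrite /u.
have b0 := sqrt1D_neq0 b; have e := sqrt1D_sqr b.
set t := Num.sqrt (1 + b ^+ 2) in b0 e *; rewrite -e.
have eb : b ^+ 2 = t ^+ 2 - 1 by rewrite e; ring.
set k := _ - a * s.
have -> : (b * (k * t - b * z) - z) / t ^+ 2 = (b * k * t - (b ^+ 2 + 1) * z) / t ^+ 2.
  by field.
by rewrite eb; field.
Qed.

Lemma is_derive_margin_a a b s z :
  is_derive a 1 (fun a' => u a' b s z)
    ((a * u a b s z + a * b * z - Num.sqrt (1 + b ^+ 2) * s) / (1 + a ^+ 2)).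
Proof.
have d := is_derive_sub (is_derive_mul (is_derive_sub
  (is_derive_scale kappa (is_derive_sqrt1Dsqr a))
  (is_derive_mul (is_derive_var a) (is_derive_const s a)))
  (is_derive_const (Num.sqrt (1 + b ^+ 2)) a)) (is_derive_const (b * z) a).
apply: (is_derive_eq d); rewrite /u.
have a0 := sqrt1D_neq0 a; have e := sqrt1D_sqr a.
set g := Num.sqrt (1 + a ^+ 2) in a0 e *; set t := Num.sqrt _; rewrite -e.
have ea : a ^+ 2 = g ^+ 2 - 1 by rewrite e; ring.
have -> : (a * ((kappa * g - a * s) * t - b * z) + a * b * z - t * s) / g ^+ 2
  = (a * kappa * g * t - (a ^+ 2 + 1) * (t * s)) / g ^+ 2 by field.
by rewrite ea; field.
Qed.

Lemma is_derive_inv_mills_b a b s z : is_derive b 1 (fun b' => A (u a b' s z))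
  (dA (u a b s z) * ((b * u a b s z - z) / (1 + b ^+ 2))).
Proof. exact: is_derive_comp (is_derive_margin_b a b s z) (is_derive_inv_mills _). Qed.

Lemma is_derive_inv_mills_a a b s z : is_derive a 1 (fun a' => A (u a' b s z))
  (dA (u a b s z) *
    ((a * u a b s z + a * b * z - Num.sqrt (1 + b ^+ 2) * s) / (1 + a ^+ 2))).
Proof. exact: is_derive_comp (is_derive_margin_a a b s z) (is_derive_inv_mills _). Qed.

Lemma is_derive_ln_tail_b a b s z : is_derive b 1 (fun b' => ln (N (u a b' s z)))
  (- A (u a b s z) * ((b * u a b s z - z) / (1 + b ^+ 2))).
Proof. exact: is_derive_comp (is_derive_margin_b a b s z) (is_derive_ln_gauss_tail _). Qed.

Lemma is_derive_ln_tail_a a b s z : is_derive a 1 (fun a' => ln (N (u a' b s z)))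
  (- A (u a b s z) *
    ((a * u a b s z + a * b * z - Num.sqrt (1 + b ^+ 2) * s) / (1 + a ^+ 2))).
Proof. exact: is_derive_comp (is_derive_margin_a a b s z) (is_derive_ln_gauss_tail _). Qed.

(** This bound contains |kappa| and serves integrability and the envelopes for differentiation; the
    constants of alpha_0 come from [margin_ab_pos]. *)
Lemma margin_ab_norm a b s z :
  `|u a b s z| <= (1 + `|kappa|) * (1 + `|a|) * (1 + `|b|) * (1 + `|s| + `|z|).
Proof.
have g0 := sqrt1D_gt0 a; have g1 := sqrt1D_le a.
have t0 := sqrt1D_gt0 b; have t1 := sqrt1D_le b.
rewrite /u; set g := Num.sqrt (1 + a ^+ 2) in g0 g1 *; set t := Num.sqrt _ in t0 t1 *.
have k0 := normr_ge0 kappa; have a0 := normr_ge0 a; have b0 := normr_ge0 b.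
have s0 := normr_ge0 s; have z0 := normr_ge0 z.
apply: le_trans (_ : (`|kappa| * g + `|a| * `|s|) * t + `|b| * `|z| <= _).
  apply: le_trans (ler_normB _ _) _; rewrite !normrM (gtr0_norm t0).
  rewrite lerD2r ler_pM2r//; apply: le_trans (ler_normB _ _) _.
  by rewrite !normrM (gtr0_norm g0).
move: `|kappa| `|a| `|b| `|s| `|z| k0 a0 b0 s0 z0 g1 t1 => k a' b' s' z' k0 a0 b0 s0 z0 g1 t1.
apply: le_trans (_ : (k * (1 + a') + a' * s') * (1 + b') + b' * z' <= _).
  have h1 : k * g + a' * s' <= k * (1 + a') + a' * s' by rewrite lerD2r ler_wpM2l.
  have h2 : 0 <= k * g + a' * s' by rewrite addr_ge0 ?mulr_ge0 ?(ltW g0).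
  by rewrite lerD2r; apply: ler_pM => //; exact: ltW.
rewrite -subr_ge0.
have -> : (1 + k) * (1 + a') * (1 + b') * (1 + s' + z')
  - ((k * (1 + a') + a' * s') * (1 + b') + b' * z') =
  (1 + a') * (1 + b') + (1 + b') * s' * (1 + k * (1 + a'))
  + z' * (1 + a' + a' * b' + k * (1 + a') * (1 + b')) by ring.
by rewrite !addr_ge0 ?mulr_ge0 ?addr_ge0 ?mulr_ge0 ?addr_ge0 ?mulr_ge0.
Qed.

Let kp := Num.max kappa 0.

Lemma margin_ab_pos a b s z : -1 <= a <= 1 ->
  Num.max (u a b s z) 0 <= 2 * Num.sqrt (1 + b ^+ 2) * (kp + `|s| + `|z|).
Proof.
move=> ha; have a1 : `|a| <= 1 by rewrite ler_norml.
have g0 := sqrt1D_gt0 a; have g1 := le_trans (sqrt1D_le a) (lerD (lexx 1) a1).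
have t0 := sqrt1D_gt0 b; have t1 := sqrt1D_ge_norm b.
have kp0 : 0 <= kp by rewrite le_max lexx orbT.
have kk : kappa <= kp by rewrite le_max lexx.
have s0 := normr_ge0 s; have z0 := normr_ge0 z.
rewrite ge_max; apply/andP; split; last by rewrite !mulr_ge0 ?addr_ge0 ?(ltW t0).
rewrite /u; set g := Num.sqrt (1 + a ^+ 2) in g0 g1 *; set t := Num.sqrt _ in t0 t1 *.
have h1 : kappa * g <= 2 * kp.
  apply: le_trans (_ : kp * g <= _); first by rewrite ler_pM2r.
  by rewrite mulrC ler_wpM2r.
have h2 : - (a * s) <= `|s|.
  by apply: le_trans (ler_norm _) _; rewrite normrN normrM ler_piMl.
have h3 : - (b * z) <= t * `|z|.
  by apply: le_trans (ler_norm _) _; rewrite normrN normrM ler_wpM2r.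
have h4 : (kappa * g - a * s) * t <= (2 * kp + `|s|) * t by rewrite ler_pM2r//; lra.
have := mulr_ge0 (ltW t0) s0; have := mulr_ge0 (ltW t0) z0; nra.
Qed.

End margin_calculus.

Definition mills_constant {R : realType} (C : R) := 1 <= C /\ forall u : R,
  [/\ inv_mills u <= C * (1 + Num.max u 0),
      inv_mills u * (inv_mills u - u) <= C,
      inv_mills u * (inv_mills u - u) * `|u| <= C * (1 + Num.max u 0) &
      - (C * (1 + Num.max u 0 ^+ 2)) <= ln (gauss_tail u)].

Section mills_constant_theory.
Context {R : realType} (C : R) (hC : mills_constant C).
Local Notation A := (@inv_mills R).
Local Notation N := (@gauss_tail R).
Local Notation dA u := (A u * (A u - u)).
Implicit Types u m p s : R.

Let C1 : 1 <= C. Proof. by case: hC. Qed.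
Let C0 : 0 <= C. Proof. exact: le_trans ler01 C1. Qed.

Lemma inv_mills_norm_le u : `|A u| <= C * (1 + `|u|).
Proof.
rewrite gtr0_norm ?inv_mills_gt0//; have [h _ _ _] := hC.2 u; apply: le_trans h _.
by rewrite ler_wpM2l// lerD2l ge_max normr_ge0 ler_norm.
Qed.

Lemma inv_mills_derive_norm_le u : `|dA u| <= C.
Proof. by rewrite ger0_norm ?inv_mills_derive_ge0//; have [] := hC.2 u. Qed.

Lemma ln_gauss_tail_norm_le u : `|ln (N u)| <= C * (1 + `|u| ^+ 2).
Proof.
rewrite ler0_norm ?ln_gauss_tail_le0// lerNl; have [_ _ _] := hC.2 u.
apply: le_trans; rewrite lerN2 ler_wpM2l// lerD2l.
by rewrite lerXn2r ?nnegrE ?le_max ?lexx ?orbT// ge_max normr_ge0 ler_norm.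
Qed.

Lemma continuous_inv_mills : continuous A.
Proof. by move=> u; exact: is_derive_continuous (is_derive_inv_mills u). Qed.

Lemma continuous_inv_mills_derive : continuous (fun u => dA u).
Proof.
move=> u; exact: is_derive_continuous (is_derive_mul (is_derive_inv_mills u)
  (is_derive_sub (is_derive_inv_mills u) (is_derive_var u))).
Qed.

Lemma measurable_inv_mills : measurable_fun setT A.
Proof. exact: continuous_measurable_fun continuous_inv_mills. Qed.

Lemma measurable_inv_mills_derive : measurable_fun setT (fun u => dA u).
Proof. exact: continuous_measurable_fun continuous_inv_mills_derive. Qed.

Lemma measurable_ln_gauss_tail : measurable_fun setT (fun u => ln (N u)).
Proof.
apply: continuous_measurable_fun => u.
exact: is_derive_continuous (is_derive_ln_gauss_tail u).
Qed.

(** The integrand of [stein_tilted] for h(s) = A(m + p s): with the other variable frozen, the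
    margin is affine in this one. *)
Definition stein_term l m p s : R :=
  s * A (m + p * s) - p * dA (m + p * s) - l * logistic (- (l * s)) * A (m + p * s).

Lemma stein_inv_mills d (T : measurableType d) (P : probability T R)
    (X : {RV P >-> R}) l m p : has_density P X (tilted_density l) ->
  P.-integrable setT (fun t => (stein_term l m p (X t))%:E) /\
  (\int[P]_t (stein_term l m p (X t))%:E = 0)%E.
Proof.
move=> hX.
have dm s : is_derive s 1 (fun s => m + p * s) p.
  apply: (is_derive_eq (is_derive_add (is_derive_const m s)
    (is_derive_scale p (is_derive_var s)))).
  by rewrite add0r mulr1.
have dh s : is_derive s 1 (fun s => A (m + p * s)) (p * dA (m + p * s)).
  by apply: (is_derive_eq (is_derive_comp (dm s) (is_derive_inv_mills _))); rewrite mulrC.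
have cdh : continuous (fun s => p * dA (m + p * s)).
  move=> s; have d1 := is_derive_inv_mills (m + p * s).
  have d2 := is_derive_mul d1 (is_derive_sub d1 (is_derive_var (m + p * s))).
  exact: is_derive_continuous (is_derive_scale p (is_derive_comp (dm s) d2)).
have q0 : 0 <= 1 + `|m| + `|p| by rewrite !addr_ge0.
have h_le s : `|A (m + p * s)| <= C * (1 + `|m| + `|p|) * (1 + `|s|).
  apply: le_trans (inv_mills_norm_le _) _; rewrite -mulrA ler_wpM2l//.
  have := ler_normD m (p * s); rewrite normrM.
  have := normr_ge0 m; have := normr_ge0 p; have := normr_ge0 s; nra.
have dh_le s : `|p * dA (m + p * s)| <= C * (1 + `|m| + `|p|).
  rewrite normrM mulrC; apply: ler_pM => //; first exact: inv_mills_derive_norm_le.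
  by rewrite lerDr addr_ge0.
have [i1 e1] := @stein_tilted _ l _ _ _ dh cdh h_le dh_le.
have mK : measurable_fun setT (stein_term l m p).
  have cA : continuous (fun s => A (m + p * s)).
    by move=> s; exact: is_derive_continuous (dh s).
  have d1 s : is_derive s 1 (fun s => logistic (- l * s))
      (logistic (- l * s) * logistic (- (- l * s)) * (- l * 1)).
    exact: is_derive_comp (is_derive_scale (- l) (is_derive_var s)) (is_derive_logistic _).
  apply: continuous_measurable_fun.
  rewrite /stein_term (_ : (fun s => _) = fun s => s * A (m + p * s) -
    p * dA (m + p * s) - l * logistic (- l * s) * A (m + p * s)); last first.
    by apply/funext => s; rewrite mulNr.
  move=> s; apply: cvgB; first apply: cvgB.
  - by apply: cvgM; [exact: cvg_id|exact: cA].
  - exact: cdh.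
  - apply: cvgM; [apply: cvgM; [exact: cvg_cst|]|exact: cA].
    exact: is_derive_continuous (d1 s).
have [i2 e2] := integrable_RV (measurable_tilted_density l)
  (tilted_density_ge0 l) hX mK i1.
by split=> //; rewrite e2.
Qed.

End mills_constant_theory.

(* Bounds the first moment and the [L^2] norm of the envelope [H] below; here [k]
   stands for the positive part of [kappa] and [c] for a bound on the second
   moments. *)
Definition lip_bound {R : realType} (C c k : R) : R := 15 * C * (1 + k) * (1 + c).

(** The inverse of a sum of three positive terms: below it each of alpha C1 <= 1/64, alpha l L <=
    1/16 and alpha L^2 <= 1/16 holds, and these are [al1], [al2] and the square of [al3]. *)
Definition alpha_bound {R : realType} (C c l k : R) : R :=
  (64 * (24 * C * (1 + k) ^+ 2 * c) + 16 * l * lip_bound C c k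
   + 16 * lip_bound C c k ^+ 2)^-1.

Lemma alpha_bound_gt0 {R : realType} (C c l k : R) :
  0 < C -> 0 < c -> 0 < l -> 0 <= k -> 0 < alpha_bound C c l k.
Proof.
move=> C0 c0 l0 k0; have k1 : 0 < 1 + k by rewrite ltr_pwDl.
have L0 : 0 < lip_bound C c k by rewrite /lip_bound !mulr_gt0// addr_gt0.
have e1 : 0 < 24 * C * (1 + k) ^+ 2 * c by rewrite !mulr_gt0 ?exprn_gt0.
have e2 : 0 < 16 * l * lip_bound C c k by apply: mulr_gt0 => //; apply: mulr_gt0.
have e3 : 0 < lip_bound C c k ^+ 2 by rewrite exprn_gt0.
by rewrite invr_gt0; lra.
Qed.

(** * Derivatives and estimates of the expectations *)

Section saddle_expectation.
Context d (T : measurableType d) (R : realType) (P : probability T R).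
Variables (S Z : {RV P >-> R}) (l kappa C c : R).
Hypotheses (hC : mills_constant C) (c0 : 0 < c) (l_gt0 : 0 < l).
Hypotheses (hS : has_density P S (tilted_density l))
  (hZ : has_density P Z (tilted_density 0)) (SZ : independent_RVs P S Z).
Hypotheses (iS : integrableR P (fun t => 1 + S t ^+ 2))
  (iZ : integrableR P (fun t => 1 + Z t ^+ 2))
  (eS : \int[P]_t (1 + S t ^+ 2) <= c) (eZ : \int[P]_t (1 + Z t ^+ 2) <= c).
Implicit Types a b s z : R.
Local Notation A := (@inv_mills R).
Local Notation N := (@gauss_tail R).
Local Notation dA u := (A u * (A u - u)).
Local Notation u a b t := (margin_ab kappa a b (S t) (Z t)).

Let C1 : 1 <= C. Proof. by case: hC. Qed.
Let C0 : 0 <= C. Proof. exact: le_trans ler01 C1. Qed.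

(** Quantities linear in the margin are dominated by multiples of [q], quadratic ones by multiples
    of [Q], which is integrable with integral at most 2 c. *)
Let q t : R := 1 + `|S t| + `|Z t|.
Let Q t : R := (1 + S t ^+ 2) + (1 + Z t ^+ 2).

Let q_ge1 t : 1 <= q t.
Proof. by rewrite /q -addrA lerDl addr_ge0. Qed.

Let Q_ge1 t : 1 <= Q t.
Proof. by rewrite /Q; have := sqr_ge0 (S t); have := sqr_ge0 (Z t); lra. Qed.

Let qQ t : q t <= Q t.
Proof.
rewrite /q /Q -(real_normK (num_real (S t))) -(real_normK (num_real (Z t))).
have := sqr_ge0 (`|S t| - 1); have := sqr_ge0 (`|Z t| - 1); nra.
Qed.

Let q2Q t : q t ^+ 2 <= 3 * Q t.
Proof.
rewrite /q /Q -(real_normK (num_real (S t))) -(real_normK (num_real (Z t))).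
have := sqr_ge0 (`|S t| - 1); have := sqr_ge0 (`|Z t| - 1).
have := sqr_ge0 (`|S t| - `|Z t|); nra.
Qed.

Let iQ : integrableR P Q. Proof. exact: integrableR_add. Qed.

Let eQ : \int[P]_t Q t <= 2 * c.
Proof. by rewrite /Q RintegralD// mulrDl mul1r lerD. Qed.

Let dominated (k : T -> R) (B : R) : measurable_fun setT k ->
  (forall t, `|k t| <= B * Q t) -> integrableR P k.
Proof. by move=> mk hk; apply: (integrable_dominated mk hk); exact: integrableR_scale. Qed.

Let mS : measurable_fun setT S. Proof. by []. Qed.
Let mZ : measurable_fun setT Z. Proof. by []. Qed.

Let mu a b : measurable_fun setT (fun t => u a b t).
Proof.
apply: measurable_funB; last exact: measurable_funM.
apply: measurable_funM => //; apply: measurable_funB => //; exact: measurable_funM.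
Qed.

Let mA a b : measurable_fun setT (fun t => A (u a b t)).
Proof. by apply: measurableT_comp (mu a b); exact: measurable_inv_mills. Qed.

Let mdA a b : measurable_fun setT (fun t => dA (u a b t)).
Proof. exact: measurableT_comp measurable_inv_mills_derive (mu a b). Qed.

Let mphi : measurable_fun setT (fun t => logistic (- (l * S t))).
Proof.
apply: measurableT_comp; first exact: measurable_logistic.
by apply: measurableT_comp => //; exact: measurable_funM.
Qed.

Let M a b : R := (1 + `|kappa|) * (1 + `|a|) * (1 + `|b|).

Let M_ge1 a b : 1 <= M a b.
Proof. by rewrite /M !mulr_ege1// lerDl. Qed.

Let M_ge0 a b : 0 <= M a b.
Proof. exact: le_trans ler01 (M_ge1 a b). Qed.

Let u_le a b t : `|u a b t| <= M a b * q t.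
Proof. by rewrite /q /M; exact: margin_ab_norm. Qed.

Let A_le a b t : `|A (u a b t)| <= 2 * C * M a b * q t.
Proof.
apply: le_trans (inv_mills_norm_le hC _) _.
have -> : 2 * C * M a b * q t = C * (2 * (M a b * q t)) by ring.
rewrite ler_wpM2l//; have := u_le a b t.
have : 1 <= M a b * q t by rewrite mulr_ege1.
lra.
Qed.

Lemma integrable_ln_tail a b : integrableR P (fun t => ln (N (u a b t))).
Proof.
apply: (@dominated _ (C * (2 * M a b ^+ 2) * 3)).
  exact: measurableT_comp measurable_ln_gauss_tail (mu a b).
move=> t; apply: le_trans (ln_gauss_tail_norm_le hC _) _.
have -> : C * (2 * M a b ^+ 2) * 3 * Q t = C * (M a b ^+ 2 * (3 * Q t) + M a b ^+ 2 * (3 * Q t)).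
  by ring.
rewrite ler_wpM2l//; have h1 := u_le a b t; have h2 := q2Q t.
have h3 : `|u a b t| ^+ 2 <= (M a b * q t) ^+ 2.
  by rewrite lerXn2r// nnegrE mulr_ge0 ?(le_trans ler01).
have h4 : 1 <= M a b * q t by rewrite mulr_ege1.
have h5 : M a b ^+ 2 * q t ^+ 2 <= M a b ^+ 2 * (3 * Q t) by rewrite ler_wpM2l// sqr_ge0.
rewrite exprMn in h3; have h6 : 1 <= M a b ^+ 2 * q t ^+ 2 by rewrite -exprMn exprn_ege1.
exact: le_trans (lerD h6 h3) (lerD h5 h5).
Qed.

Let integrable_A_mul a b (k : T -> R) : measurable_fun setT k ->
  (exists2 B, 0 <= B & forall t, `|k t| <= B * q t) -> integrableR P (fun t => k t * A (u a b t)).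
Proof.
move=> mk [B B0 hB]; apply: (@dominated _ (B * (2 * C * M a b) * 3)).
  exact: measurable_funM.
move=> t; rewrite normrM.
apply: le_trans (_ : (B * q t) * (2 * C * M a b * q t) <= _).
  by apply: ler_pM.
have -> : B * q t * (2 * C * M a b * q t) = B * (2 * C * M a b) * q t ^+ 2 by ring.
have -> : B * (2 * C * M a b) * 3 * Q t = B * (2 * C * M a b) * (3 * Q t) by ring.
by rewrite ler_wpM2l// !mulr_ge0.
Qed.

Lemma integrable_sqr_A a b : integrableR P (fun t => A (u a b t) ^+ 2).
Proof.
apply: (@integrable_A_mul a b (fun t => A (u a b t))) => //.
by exists (2 * C * M a b); [rewrite !mulr_ge0|exact: A_le].
Qed.

Lemma integrable_AA a b a' b' : integrableR P (fun t => A (u a b t) * A (u a' b' t)).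
Proof.
apply: (@integrable_A_mul a' b' (fun t => A (u a b t))) => //.
by exists (2 * C * M a b); [rewrite !mulr_ge0|exact: A_le].
Qed.

Let logistic_norm t : `|logistic (- (l * S t))| <= 1.
Proof. by rewrite gtr0_norm ?logistic_gt0// logistic_le1. Qed.

Lemma integrable_phiA a b :
  integrableR P (fun t => logistic (- (l * S t)) * A (u a b t)).
Proof.
apply: integrable_A_mul => //; exists 1 => // t; rewrite mul1r.
exact: le_trans (logistic_norm t) (q_ge1 t).
Qed.

Let integrable_SA a b : integrableR P (fun t => S t * A (u a b t)).
Proof.
by apply: integrable_A_mul => //; exists 1 => // t; rewrite mul1r /q addrAC lerDr addr_ge0.
Qed.

Let integrable_ZA a b : integrableR P (fun t => Z t * A (u a b t)).
Proof.
by apply: integrable_A_mul => //; exists 1 => // t; rewrite mul1r /q lerDr addr_ge0.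
Qed.

Let integrable_dA a b : integrableR P (fun t => dA (u a b t)).
Proof.
apply: (@dominated _ C) => // t; apply: le_trans (inv_mills_derive_norm_le hC _) _.
by rewrite ler_peMr.
Qed.

(* By Stein's identity these have mean zero; the slopes of [ln (N (u a b t))] are
   linear combinations of them and of the integrands in the claimed derivatives. *)
Let XS a b t : R := S t * A (u a b t) + a * Num.sqrt (1 + b ^+ 2) * dA (u a b t)
  - l * logistic (- (l * S t)) * A (u a b t).
Let XZ a b t : R := Z t * A (u a b t) + b * dA (u a b t).

Let integrable_XS a b : integrableR P (XS a b).
Proof.
rewrite /XS; apply: integrableR_sub; first apply: integrableR_add => //.
  exact: integrableR_scale.
rewrite (_ : (fun t => _) = fun t => l * (logistic (- (l * S t)) * A (u a b t))).
  by apply: integrableR_scale; exact: integrable_phiA.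
by apply/funext => t; rewrite mulrA.
Qed.

Let integrable_XZ a b : integrableR P (XZ a b).
Proof. by rewrite /XZ; apply: integrableR_add => //; exact: integrableR_scale. Qed.

Let stein_S a b : \int[P]_t XS a b t = 0.
Proof.
set be := Num.sqrt (1 + b ^+ 2).
(* With Z frozen the margin is affine in S with slope - a sqrt (1 + b^2). *)
pose K (x : R * R) := stein_term l (kappa * Num.sqrt (1 + a ^+ 2) * be - b * x.2)
   (- (a * be)) x.1.
have Ku t : XS a b t = K (S t, Z t).
  have eu : kappa * Num.sqrt (1 + a ^+ 2) * be - b * Z t + - (a * be) * S t = u a b t.
    by rewrite /margin_ab -/be; ring.
  by rewrite /XS /K /stein_term /= eu -/be mulNr opprK.
rewrite /Rintegral; under eq_integral do rewrite Ku.
rewrite (@integral_indep_slice _ _ _ _ S Z K SZ)//.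
- rewrite /K /stein_term.
  have mm : measurable_fun setT (fun x : R * R =>
    kappa * Num.sqrt (1 + a ^+ 2) * be - b * x.2 + - (a * be) * x.1).
    apply: measurable_funD; last exact: measurable_funM.
    by apply: measurable_funB => //; exact: measurable_funM.
  have mA' := measurableT_comp measurable_inv_mills mm.
  have mdA' := measurableT_comp measurable_inv_mills_derive mm.
  apply: measurable_funB; first apply: measurable_funB.
  + exact: measurable_funM.
  + exact: measurable_funM.
  + apply: measurable_funM => //; apply: measurable_funM => //.
    apply: measurableT_comp; first exact: measurable_logistic.
    by apply: measurableT_comp => //; exact: measurable_funM.
- have := integrable_XS a b; rewrite /integrableR.
  by congr (P.-integrable setT _); apply/funext => t; rewrite Ku.
- by move=> z; have [] := @stein_inv_mills _ _ hC _ _ _ S l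
   (kappa * Num.sqrt (1 + a ^+ 2) * be - b * z) (- (a * be)) hS.
- by move=> z; have [] := @stein_inv_mills _ _ hC _ _ _ S l
   (kappa * Num.sqrt (1 + a ^+ 2) * be - b * z) (- (a * be)) hS.
Qed.

Let stein_Z a b : \int[P]_t XZ a b t = 0.
Proof.
(* The roles are exchanged: S is frozen and the slope in Z is - b. The parameter 0 stands for the
   Gaussian law and removes the logistic term. *)
pose K (x : R * R) :=
  stein_term 0 ((kappa * Num.sqrt (1 + a ^+ 2) - a * x.2) * Num.sqrt (1 + b ^+ 2)) (- b) x.1.
have ZS : independent_RVs P Z S by move=> U V mU mV; rewrite setIC SZ// muleC.
have Ku t : XZ a b t = K (Z t, S t).
  have eu : (kappa * Num.sqrt (1 + a ^+ 2) - a * S t) * Num.sqrt (1 + b ^+ 2) + - b * Z t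
    = u a b t by rewrite /margin_ab; ring.
  by rewrite /XZ /K /stein_term /= eu mulNr opprK !mul0r subr0.
rewrite /Rintegral; under eq_integral do rewrite Ku.
rewrite (@integral_indep_slice _ _ _ _ Z S K ZS)//.
- rewrite /K /stein_term.
  have mm : measurable_fun setT (fun x : R * R =>
    (kappa * Num.sqrt (1 + a ^+ 2) - a * x.2) * Num.sqrt (1 + b ^+ 2) + - b * x.1).
    apply: measurable_funD; last exact: measurable_funM.
    by apply: measurable_funM => //; apply: measurable_funB => //; exact: measurable_funM.
  have mA' := measurableT_comp measurable_inv_mills mm.
  have mdA' := measurableT_comp measurable_inv_mills_derive mm.
  apply: measurable_funB; first apply: measurable_funB.
  + exact: measurable_funM.
  + exact: measurable_funM.
  + apply: measurable_funM => //; apply: measurable_funM => //.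
    apply: measurableT_comp; first exact: measurable_logistic.
    by apply: measurableT_comp => //; exact: measurable_funM.
- have := integrable_XZ a b; rewrite /integrableR.
  by congr (P.-integrable setT _); apply/funext => t; rewrite Ku.
- by move=> s; have [] := @stein_inv_mills _ _ hC _ _ _ Z 0
   ((kappa * Num.sqrt (1 + a ^+ 2) - a * s) * Num.sqrt (1 + b ^+ 2)) (- b) hZ.
- by move=> s; have [] := @stein_inv_mills _ _ hC _ _ _ Z 0
   ((kappa * Num.sqrt (1 + a ^+ 2) - a * s) * Num.sqrt (1 + b ^+ 2)) (- b) hZ.
Qed.

Definition mean_ln_tail a b : R := \int[P]_t ln (N (u a b t)).
Definition mean_phi_mills a b : R := \int[P]_t (logistic (- (l * S t)) * A (u a b t)).
Definition mean_sqr_mills a b : R := \int[P]_t (A (u a b t) ^+ 2).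

Let M_mono a b a' b' : `|a| <= `|a'| -> `|b| <= `|b'| -> M a b <= M a' b'.
Proof.
move=> aa bb; rewrite /M; apply: ler_pM; rewrite ?mulr_ge0 ?addr_ge0 ?lerD2l//.
by rewrite ler_wpM2l ?lerD2l// addr_ge0.
Qed.

Let slope_dominated a b a' b' t (v : R) : `|a| <= `|a'| -> `|b| <= `|b'| ->
  `|v| <= 2 * M a' b' * q t ->
  `|- A (u a b t) * v| <= 12 * C * M a' b' ^+ 2 * Q t.
Proof.
move=> aa bb hv; rewrite normrM normrN.
have h1 : `|A (u a b t)| <= 2 * C * M a' b' * q t.
  apply: le_trans (A_le a b t) _; rewrite ler_wpM2r ?(le_trans ler01)//.
  by rewrite ler_wpM2l ?mulr_ge0// M_mono.
apply: le_trans (ler_pM _ _ h1 hv) _ => //.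
have -> : 2 * C * M a' b' * q t * (2 * M a' b' * q t) = 4 * C * M a' b' ^+ 2 * q t ^+ 2 by ring.
have -> : 12 * C * M a' b' ^+ 2 * Q t = 4 * C * M a' b' ^+ 2 * (3 * Q t) by ring.
by rewrite ler_wpM2l// !mulr_ge0// sqr_ge0.
Qed.

Let norm_add1 (x y : R) : `|x - y| < 1 -> `|x| <= `| `|y| + 1|.
Proof.
move=> xy; rewrite [leRHS]ger0_norm ?addr_ge0//.
have := ler_normD y (x - y); rewrite subrKC; lra.
Qed.

Let Z_le t : `|Z t| <= q t. Proof. by rewrite /q lerDr addr_ge0. Qed.

Lemma is_derive_mean_ln_tail_b a b : is_derive b 1 (mean_ln_tail a)
  (- (b / (1 + b ^+ 2) * mean_sqr_mills a b)).
Proof.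
pose df b' t := - A (u a b' t) * ((b' * u a b' t - Z t) / (1 + b' ^+ 2)).
set B := 12 * C * M a (`|b| + 1) ^+ 2.
have B0 : 0 <= B by rewrite !mulr_ge0// sqr_ge0.
have hd : is_derive b 1 (mean_ln_tail a) (\int[P]_t df b t).
  apply: (@is_derive_integralR _ _ _ P (fun b' t => ln (N (u a b' t))) df (fun t => B * Q t)).
  - by move=> b'; exact: integrable_ln_tail.
  - by move=> b' t; exact: is_derive_ln_tail_b.
  - exact: integrableR_scale.
  - by move=> t; rewrite mulr_ge0// (le_trans ler01).
  - move=> b' t hb'; have nb : `|b'| <= `| `|b| + 1|.
      by apply: norm_add1; rewrite ltr_norml; lra.
    apply: slope_dominated => //.
    have p0 : 0 < 1 + b' ^+ 2 by rewrite ltr_pwDl// sqr_ge0.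
    have b'1 : `|b'| <= 1 + b' ^+ 2.
      by rewrite -(real_normK (num_real b')); have := sqr_ge0 (`|b'| - 1); nra.
    have m1 : M a b' <= M a (`|b| + 1) by rewrite M_mono.
    have h1 := u_le a b' t; have h2 := Z_le t; have h3 := q_ge1 t.
    have h4 := M_ge1 a (`|b| + 1).
    have h5 : M a b' * q t <= M a (`|b| + 1) * q t by rewrite ler_wpM2r// (le_trans ler01).
    have h6 : q t <= M a (`|b| + 1) * q t by rewrite ler_peMl// (le_trans ler01).
    rewrite normrM normfV (gtr0_norm p0) ler_pdivrMr//.
    apply: le_trans (ler_normB _ _) _; rewrite normrM.
    have e1 : `|b'| * `|u a b' t| <= (1 + b' ^+ 2) * (M a (`|b| + 1) * q t).
      by apply: ler_pM => //; exact: le_trans h1 h5.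
    have e2 : `|Z t| <= (1 + b' ^+ 2) * (M a (`|b| + 1) * q t).
      apply: le_trans (le_trans h2 h6) _; rewrite ler_peMl ?lerDl ?sqr_ge0//.
      by rewrite mulr_ge0// (le_trans ler01).
    by apply: le_trans (lerD e1 e2) _; rewrite le_eqVlt; apply/orP; left; apply/eqP; ring.
apply: (is_derive_eq hd).
have p0 : 1 + b ^+ 2 != 0 by rewrite gt_eqF// ltr_pwDl// sqr_ge0.
(* Here A' = A (A - u) replaces - b A u by b A' - b A^2, and Z A + b A' has mean zero. *)
have -> : \int[P]_t df b t = \int[P]_t ((1 + b ^+ 2)^-1 * (XZ a b t - b * A (u a b t) ^+ 2)).
  by apply: eq_Rintegral => t _; rewrite /df /XZ; field.
have ib : integrableR P (fun t => b * A (u a b t) ^+ 2).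
  by apply: integrableR_scale; exact: integrable_sqr_A.
rewrite RintegralZl//; last exact: integrableR_sub.
have iXZ := integrable_XZ a b; rewrite RintegralB// stein_Z RintegralZl//;
  last exact: integrable_sqr_A.
by rewrite /mean_sqr_mills; ring.
Qed.

Lemma is_derive_mean_ln_tail_a a b : is_derive a 1 (mean_ln_tail ^~ b)
  ((1 + a ^+ 2)^-1 *
   (Num.sqrt (1 + b ^+ 2) * l * mean_phi_mills a b - a * mean_sqr_mills a b)).
Proof.
set be := Num.sqrt (1 + b ^+ 2).
have be0 : 0 < be by exact: sqrt1D_gt0.
have be1 : be <= 1 + `|b| by exact: sqrt1D_le.
pose df a' t := - A (u a' b t) * ((a' * u a' b t + a' * b * Z t - be * S t) / (1 + a' ^+ 2)).
set B := 12 * C * M (`|a| + 1) b ^+ 2.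
have B0 : 0 <= B by rewrite !mulr_ge0// sqr_ge0.
have hd : is_derive a 1 (mean_ln_tail ^~ b) (\int[P]_t df a t).
  apply: (@is_derive_integralR _ _ _ P (fun a' t => ln (N (u a' b t))) df (fun t => B * Q t)).
  - by move=> a'; exact: integrable_ln_tail.
  - by move=> a' t; exact: is_derive_ln_tail_a.
  - exact: integrableR_scale.
  - by move=> t; rewrite mulr_ge0// (le_trans ler01).
  - move=> a' t ha'; have na : `|a'| <= `| `|a| + 1|.
      by apply: norm_add1; rewrite ltr_norml; lra.
    apply: slope_dominated => //.
    have p0 : 0 < 1 + a' ^+ 2 by rewrite ltr_pwDl// sqr_ge0.
    have a'1 : `|a'| <= 1 + a' ^+ 2.
      by rewrite -(real_normK (num_real a')); have := sqr_ge0 (`|a'| - 1); nra.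
    have m1 : M a' b <= M (`|a| + 1) b by rewrite M_mono.
    have h1 := u_le a' b t; have h3 := q_ge1 t.
    set m := M (`|a| + 1) b in m1 *.
    have h5 : M a' b * q t <= m * q t by rewrite ler_wpM2r// (le_trans ler01).
    have h6 : 1 + `|b| <= m.
      rewrite /m /M ler_peMl ?addr_ge0// mulr_ege1// lerDl//.
    rewrite normrM normfV (gtr0_norm p0) ler_pdivrMr//.
    have e1 : `|a' * u a' b t| <= (1 + a' ^+ 2) * (m * q t).
      by rewrite normrM; apply: ler_pM => //; exact: le_trans h1 h5.
    have e2 : `|a' * b * Z t| <= (1 + a' ^+ 2) * (`|b| * `|Z t|).
      by rewrite -mulrA normrM normrM ler_wpM2r// mulr_ge0.
    have e3 : `|be * S t| <= (1 + a' ^+ 2) * ((1 + `|b|) * `|S t|).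
      rewrite normrM (gtr0_norm be0) mulrA ler_wpM2r//.
      by apply: le_trans be1 _; rewrite ler_peMl ?addr_ge0// lerDl sqr_ge0.
    have e4 : m * q t + `|b| * `|Z t| + (1 + `|b|) * `|S t| <= 2 * m * q t.
      have k1 : (1 + `|b|) * q t <= m * q t by rewrite ler_wpM2r// (le_trans ler01).
      have k2 : (1 + `|b|) * q t = 1 + `|b| + (1 + `|b|) * `|S t| + (1 + `|b|) * `|Z t|.
        by rewrite /q; ring.
      by have := normr_ge0 b; have := normr_ge0 (Z t); lra.
    apply: le_trans (ler_normB _ _) _.
    apply: le_trans (lerD (le_trans (ler_normD _ _) (lerD e1 e2)) e3) _.
    by rewrite -!mulrDr mulrC ler_pM2r.
apply: (is_derive_eq hd).
have p0 : 1 + a ^+ 2 != 0 by rewrite gt_eqF// ltr_pwDl// sqr_ge0.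
have eb : be ^+ 2 = 1 + b ^+ 2 by exact: sqrt1D_sqr.
(* The weights are chosen so that the terms in S A and Z A match; A' then has coefficient a (1 +
   b^2) - a b^2 = a, and a A' - a A^2 = - a A u. *)
pose X t := be * XS a b t - (a * b) * XZ a b t
  + (be * l * (logistic (- (l * S t)) * A (u a b t)) - a * A (u a b t) ^+ 2).
have -> : \int[P]_t df a t = \int[P]_t ((1 + a ^+ 2)^-1 * X t).
  apply: eq_Rintegral => t _; rewrite /df /X /XZ /XS -/be.
  have -> : be * (S t * A (u a b t) + a * be * dA (u a b t)
    - l * logistic (- (l * S t)) * A (u a b t)) = be * (S t * A (u a b t)) +
    a * be ^+ 2 * dA (u a b t) - be * l * logistic (- (l * S t)) * A (u a b t) by ring.
  by rewrite eb; field.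
have i1 : integrableR P (fun t => be * XS a b t) by exact: integrableR_scale.
have i2 : integrableR P (fun t => (a * b) * XZ a b t) by exact: integrableR_scale.
have i3 : integrableR P (fun t => be * l * (logistic (- (l * S t)) * A (u a b t))).
  by apply: integrableR_scale; exact: integrable_phiA.
have i4 : integrableR P (fun t => a * A (u a b t) ^+ 2).
  by apply: integrableR_scale; exact: integrable_sqr_A.
have iXZ := integrable_XZ a b; have iXS := integrable_XS a b.
have ip := integrable_phiA a b; have iA := integrable_sqr_A a b.
have i12 := integrableR_sub i1 i2; have i34 := integrableR_sub i3 i4.
rewrite RintegralZl//; last exact: integrableR_add.
congr (_ * _); rewrite /X RintegralD// RintegralB// [X in _ + X]RintegralB//.
rewrite (RintegralZl _ measurableT iXS) (RintegralZl _ measurableT iXZ).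
rewrite (RintegralZl _ measurableT ip) (RintegralZl _ measurableT iA).
by rewrite stein_S stein_Z !mulr0 subrr add0r.
Qed.

Let kp : R := Num.max kappa 0.
Let kp0 : 0 <= kp. Proof. by rewrite le_max lexx orbT. Qed.

(* Dominates, on the rectangle [|a| <= 1], [0 <= b <= 1], both [A (u a b t)] and
   its partial derivatives in [a] and [b]. *)
Let H t : R := 6 * C * (1 + kp) * q t.

Let H_ge0 t : 0 <= H t.
Proof. by rewrite /H !mulr_ge0// ?addr_ge0// (le_trans ler01). Qed.

Let sqrt_le2 b : 0 <= b <= 1 -> Num.sqrt (1 + b ^+ 2) <= 2.
Proof.
by move=> /andP[b0 b1]; have := sqrt1D_le b; rewrite ger0_norm//; lra.
Qed.

Let pos_le a b t : -1 <= a <= 1 -> 0 <= b <= 1 ->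
  1 + Num.max (u a b t) 0 <= 4 * (1 + kp) * q t.
Proof.
move=> ha hb; have h := margin_ab_pos kappa b (S t) (Z t) ha.
have b2 := sqrt_le2 hb; rewrite -/kp in h.
have s0 := normr_ge0 (S t); have z0 := normr_ge0 (Z t).
have w0 : 0 <= kp + `|S t| + `|Z t| by rewrite !addr_ge0.
have h2 : 2 * Num.sqrt (1 + b ^+ 2) * (kp + `|S t| + `|Z t|) <= 4 * (kp + `|S t| + `|Z t|).
  by rewrite ler_wpM2r//; lra.
rewrite /q; have := mulr_ge0 kp0 s0; have := mulr_ge0 kp0 z0; lra.
Qed.

Let A_le_H a b t : -1 <= a <= 1 -> 0 <= b <= 1 -> A (u a b t) <= H t.
Proof.
move=> ha hb; have [h _ _ _] := hC.2 (u a b t); apply: le_trans h _.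
have -> : H t = C * (4 * (1 + kp) * q t) + 2 * C * (1 + kp) * q t by rewrite /H; ring.
apply: ler_wpDr; first by rewrite !mulr_ge0// ?addr_ge0// (le_trans ler01).
by rewrite ler_wpM2l// pos_le.
Qed.

(** The part of the slope proportional to u is absorbed by the bound on A'(u) |u|, the rest by the
    bound on A'(u); both involve only the positive part of kappa. *)
Let slope_le_H a b t (v k : R) : -1 <= a <= 1 -> 0 <= b <= 1 -> 1 <= k ->
  `|v| <= (`|u a b t| + 2 * q t) * k -> `|dA (u a b t) * (v / k)| <= H t.
Proof.
move=> ha hb k1 hv; have k0 : 0 < k by lra.
have [_ h2 h3 _] := hC.2 (u a b t); have d0 := inv_mills_derive_ge0 (u a b t).
rewrite normrM normf_div (ger0_norm d0) (gtr0_norm k0).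
apply: le_trans (_ : dA (u a b t) * (`|u a b t| + 2 * q t) <= _).
  by rewrite ler_wpM2l// ler_pdivrMr.
rewrite mulrDr.
have e1 : dA (u a b t) * `|u a b t| <= C * (4 * (1 + kp) * q t).
  by apply: le_trans h3 _; rewrite ler_wpM2l// pos_le.
have q0 : 0 <= q t by rewrite (le_trans ler01).
have e2 : dA (u a b t) * (2 * q t) <= C * (2 * q t) by rewrite ler_wpM2r// mulr_ge0.
apply: le_trans (lerD e1 e2) _.
have -> : H t = C * (4 * (1 + kp) * q t) + C * (2 * q t) + 2 * C * kp * q t.
  by rewrite /H; ring.
by rewrite lerDl !mulr_ge0.
Qed.

Let A_lip a b a' b' t : -1 <= a <= 1 -> -1 <= a' <= 1 -> 0 <= b <= 1 -> 0 <= b' <= 1 ->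
  `|A (u a b t) - A (u a' b' t)| <= H t * (`|a - a'| + `|b - b'|).
Proof.
move=> ha ha' hb hb'.
have -> : A (u a b t) - A (u a' b' t) =
  (A (u a b t) - A (u a' b t)) + (A (u a' b t) - A (u a' b' t)) by ring.
apply: le_trans (ler_normD _ _) _; rewrite mulrDr; apply: lerD.
  apply: (bounded_derive_lipschitz (fun x _ =>
    is_derive_inv_mills_a kappa x b (S t) (Z t)) _ ha ha').
  move=> x hx; have x1 : 1 <= 1 + x ^+ 2 by rewrite lerDl sqr_ge0.
  apply: slope_le_H => //.
  have nx : `|x| <= 1 by rewrite ler_norml.
  have nb : `|b| <= 1 by rewrite ler_norml; lra.
  have e1 : `|x * u x b t| <= `|u x b t| by rewrite normrM ler_piMl.
  have e2 : `|x * b * Z t| <= `|Z t| by rewrite normrM ler_piMl// normrM mulr_ile1.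
  have e3 : `|Num.sqrt (1 + b ^+ 2) * S t| <= 2 * `|S t|.
    by rewrite normrM ler_wpM2r// ger0_norm ?sqrt_le2// sqrtr_ge0.
  apply: le_trans (_ : `|u x b t| + 2 * q t <= _); last first.
    by rewrite ler_peMr// addr_ge0// mulr_ge0// (le_trans ler01).
  apply: le_trans (ler_normB _ _) _.
  apply: le_trans (lerD (le_trans (ler_normD _ _) (lerD e1 e2)) e3) _.
  by rewrite /q; have := normr_ge0 (Z t); lra.
apply: (bounded_derive_lipschitz (fun x _ =>
  is_derive_inv_mills_b kappa a' x (S t) (Z t)) _ hb hb').
move=> x hx; have x1 : 1 <= 1 + x ^+ 2 by rewrite lerDl sqr_ge0.
apply: slope_le_H => //.
have nx : `|x| <= 1 by rewrite ler_norml; lra.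
have e1 : `|x * u a' x t| <= `|u a' x t| by rewrite normrM ler_piMl.
apply: le_trans (_ : `|u a' x t| + 2 * q t <= _); last first.
  by rewrite ler_peMr// addr_ge0// mulr_ge0// (le_trans ler01).
apply: le_trans (ler_normB _ _) _; apply: le_trans (lerD e1 (Z_le t)) _.
by rewrite lerD2l ler_peMl ?(le_trans ler01)//; lra.
Qed.

Let L : R := lip_bound C c kp.

Let L_gt0 : 0 < L.
Proof.
have C_gt0 := lt_le_trans ltr01 C1; have k0 : 0 < 1 + kp by rewrite ltr_pwDl.
by rewrite /L /lip_bound !mulr_gt0// addr_gt0.
Qed.

Let mq : measurable_fun setT q.
Proof.
apply: measurable_funD; [apply: measurable_funD => //|].
  by apply: measurableT_comp.
by apply: measurableT_comp.
Qed.

Let iH : integrableR P H.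
Proof.
apply: integrableR_scale; apply: (@dominated _ 1) => // t.
by rewrite mul1r ger0_norm// (le_trans ler01).
Qed.

Let iH2 : integrableR P (fun t => H t ^+ 2).
Proof.
rewrite (_ : (fun t => _) = fun t => (6 * C * (1 + kp)) ^+ 2 * q t ^+ 2); last first.
  by apply/funext => t; rewrite exprMn.
apply: integrableR_scale; apply: (@dominated _ 3); first exact: measurable_funX.
by move=> t; rewrite ger0_norm ?sqr_ge0.
Qed.

Let eH : \int[P]_t H t <= L.
Proof.
apply: le_trans (_ : \int[P]_t (6 * C * (1 + kp) * Q t) <= _).
  apply: integralR_le => //; first exact: integrableR_scale.
  by move=> t; rewrite /H ler_wpM2l// !mulr_ge0// addr_ge0.
rewrite RintegralZl//.
have k0 : 0 <= C * (1 + kp) by rewrite mulr_ge0// addr_ge0.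
have := ler_wpM2l k0 eQ; rewrite /L /lip_bound.
by have := mulr_ge0 k0 (ltW c0); lra.
Qed.

Let eH2 : \int[P]_t (H t ^+ 2) <= L ^+ 2.
Proof.
apply: le_trans (_ : \int[P]_t ((6 * C * (1 + kp)) ^+ 2 * 3 * Q t) <= _).
  apply: integralR_le => //; first exact: integrableR_scale.
  by move=> t; rewrite /H exprMn -[leRHS]mulrA ler_wpM2l// sqr_ge0.
rewrite RintegralZl//.
have k0 : 0 <= (6 * C * (1 + kp)) ^+ 2 * 3 by rewrite mulr_ge0// sqr_ge0.
apply: le_trans (ler_wpM2l k0 eQ) _.
(* The factor 15 in [lip_bound] comes from here: 15^2 = 225 covers 216, and c <= (1 + c)^2. *)
have -> : (6 * C * (1 + kp)) ^+ 2 * 3 * (2 * c) = (C * (1 + kp)) ^+ 2 * (216 * c) by ring.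
have -> : L ^+ 2 = (C * (1 + kp)) ^+ 2 * (225 * (1 + c) ^+ 2) by rewrite /L /lip_bound; ring.
rewrite ler_wpM2l ?sqr_ge0//; have := sqr_ge0 c; have := c0; nra.
Qed.

Let R2 a b : R := Num.sqrt (mean_sqr_mills a b).

Let mean_sqr_gt0 a b : 0 < mean_sqr_mills a b.
Proof.
apply: integralR_gt0; first exact: integrable_sqr_A.
by move=> t; rewrite exprn_gt0// inv_mills_gt0.
Qed.

Let R2_sqr a b : R2 a b ^+ 2 = mean_sqr_mills a b.
Proof. by rewrite sqr_sqrtr// ltW. Qed.

Let R2_bd a b : -1 <= a <= 1 -> 0 <= b <= 1 -> 0 < R2 a b <= L.
Proof.
move=> ha hb; rewrite sqrtr_gt0 mean_sqr_gt0/=.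
rewrite -(ger0_norm (ltW L_gt0)) -sqrtr_sqr ler_wsqrtr//; apply: le_trans eH2.
apply: integralR_le => //; first exact: integrable_sqr_A.
by move=> t; rewrite lerXn2r ?nnegrE ?(ltW (inv_mills_gt0 _))// A_le_H.
Qed.

Let A1_bd a b : -1 <= a <= 1 -> 0 <= b <= 1 -> 0 < mean_phi_mills a b <= L.
Proof.
move=> ha hb; apply/andP; split.
  apply: integralR_gt0; first exact: integrable_phiA.
  by move=> t; rewrite mulr_gt0 ?logistic_gt0 ?inv_mills_gt0.
apply: le_trans eH; apply: integralR_le => //; first exact: integrable_phiA.
move=> t; apply: le_trans (A_le_H t ha hb).
by rewrite ler_piMl ?logistic_le1// ltW ?inv_mills_gt0.
Qed.

Let A1_lip a a' b b' : -1 <= a <= 1 -> -1 <= a' <= 1 -> 0 <= b <= 1 -> 0 <= b' <= 1 ->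
  `|mean_phi_mills a b - mean_phi_mills a' b'| <= L * (`|a - a'| + `|b - b'|).
Proof.
move=> ha ha' hb hb'; set r := `|a - a'| + `|b - b'|.
have r0 : 0 <= r by rewrite addr_ge0.
have i1 := integrable_phiA a b; have i2 := integrable_phiA a' b'.
have i3 := integrableR_sub i1 i2.
rewrite -RintegralB//; apply: le_trans (le_normr_Rintegral _ i3) _ => //.
apply: le_trans (_ : \int[P]_t (r * H t) <= _); last first.
  by rewrite RintegralZl// mulrC ler_wpM2r.
apply: integralR_le; last 1 first.
- move=> t; rewrite -mulrBr normrM mulrC [leRHS]mulrC -[leRHS]mulr1.
  by apply: ler_pM => //; exact: A_lip.
- by have := integrable_norm i3.
- exact: integrableR_scale.
Qed.

(** As an L^2 norm, [R2] varies by at most the norm of the difference of the two A(u), which [A_lip]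
    bounds through the norm of [H]. *)
Let R2_lip a a' b b' : -1 <= a <= 1 -> -1 <= a' <= 1 -> 0 <= b <= 1 -> 0 <= b' <= 1 ->
  `|R2 a b - R2 a' b'| <= L * (`|a - a'| + `|b - b'|).
Proof.
move=> ha ha' hb hb'; set r := `|a - a'| + `|b - b'|.
have r0 : 0 <= r by rewrite addr_ge0.
apply: sqrt_second_moment_lip; try exact: integrable_sqr_A; try exact: mean_sqr_gt0.
- exact: integrable_AA.
- by rewrite mulr_ge0// ltW.
apply: le_trans (_ : \int[P]_t (r ^+ 2 * H t ^+ 2) <= _); last first.
  by rewrite RintegralZl// exprMn mulrC ler_wpM2r// sqr_ge0.
apply: integralR_le; last 1 first.
- move=> t; rewrite -exprMn -(real_normK (num_real (A _ - A _))).
  have hA := A_lip t ha ha' hb hb'; rewrite -/r mulrC in hA.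
  by rewrite lerXn2r// nnegrE mulr_ge0.
- rewrite (_ : (fun t => _) = fun t => A (u a b t) ^+ 2 + A (u a' b' t) ^+ 2
    - 2 * (A (u a b t) * A (u a' b' t))).
    apply: integrableR_sub; first by apply: integrableR_add; exact: integrable_sqr_A.
    by apply: integrableR_scale; exact: integrable_AA.
  by apply/funext => t; ring.
- exact: integrableR_scale.
Qed.

Lemma mean_ln_tail_le0 a b : mean_ln_tail a b <= 0.
Proof.
rewrite -[leRHS](integralR_cst P 0); apply: integralR_le.
- exact: integrable_ln_tail.
- exact: integrableR_cst.
- by move=> t; exact: ln_gauss_tail_le0.
Qed.

Let C1' : R := 24 * C * (1 + kp) ^+ 2 * c.

Let mean_ln_tail_ge a b : -1 <= a <= 1 -> - (C1' * (1 + b ^+ 2)) <= mean_ln_tail a b.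
Proof.
move=> ha; set be := 1 + b ^+ 2; have be1 : 1 <= be by rewrite lerDl sqr_ge0.
(* In this proof [be] is 1 + b^2, without a root. The 12 is 4 from squaring [margin_ab_pos] times 3
   from the square of a sum of three terms; the bound 2 c on the integral of [Q] makes it 24 in
   [C1']. *)
pose k := 12 * C * (1 + kp) ^+ 2 * be.
have k0 : 0 <= k.
  apply: mulr_ge0; last exact: le_trans ler01 be1.
  by apply: mulr_ge0; [exact: mulr_ge0|exact: sqr_ge0].
apply: le_trans (_ : \int[P]_t (- k * Q t) <= _).
  rewrite RintegralZl// mulNr lerN2; apply: le_trans (ler_wpM2l k0 eQ) _.
  by rewrite le_eqVlt; apply/orP; left; apply/eqP; rewrite /k /C1'; ring.
apply: integralR_le; [exact: integrableR_scale|exact: integrable_ln_tail|].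
move=> t; have [_ _ _] := hC.2 (u a b t); apply: le_trans.
rewrite mulNr lerN2.
have -> : k * Q t = C * (12 * (1 + kp) ^+ 2 * be * Q t) by rewrite /k; ring.
rewrite ler_wpM2l//.
have h := margin_ab_pos kappa b (S t) (Z t) ha; rewrite -/kp in h.
have s0 := normr_ge0 (S t); have z0 := normr_ge0 (Z t).
have w0 : 0 <= kp + `|S t| + `|Z t| by rewrite !addr_ge0.
have h2 : Num.max (u a b t) 0 ^+ 2 <= 4 * be * (kp + `|S t| + `|Z t|) ^+ 2.
  apply: le_trans (_ : (2 * Num.sqrt be * (kp + `|S t| + `|Z t|)) ^+ 2 <= _).
    by rewrite lerXn2r ?nnegrE// ?le_max ?lexx ?orbT// !mulr_ge0// sqrtr_ge0.
  rewrite !exprMn sqr_sqrtr ?(le_trans ler01)// le_eqVlt; apply/orP; left; apply/eqP; ring.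
have h3 : (kp + `|S t| + `|Z t|) ^+ 2 <= 3 * (kp ^+ 2 + S t ^+ 2 + Z t ^+ 2).
  rewrite -(real_normK (num_real (S t))) -(real_normK (num_real (Z t))).
  have := sqr_ge0 (kp - `|S t|); have := sqr_ge0 (kp - `|Z t|).
  have := sqr_ge0 (`|S t| - `|Z t|); nra.
have h4 : 3 * (kp ^+ 2 + S t ^+ 2 + Z t ^+ 2) + 1 <= 3 * (1 + kp) ^+ 2 * Q t.
  have q2 : 2 <= Q t by rewrite /Q; have := sqr_ge0 (S t); have := sqr_ge0 (Z t); lra.
  have e : S t ^+ 2 + Z t ^+ 2 = Q t - 2 by rewrite /Q; ring.
  have -> : kp ^+ 2 + S t ^+ 2 + Z t ^+ 2 = kp ^+ 2 + (Q t - 2) by rewrite -e; ring.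
  have := mulr_ge0 kp0 (le_trans (ler0n _ _) q2).
  have : kp ^+ 2 * 2 <= kp ^+ 2 * Q t by rewrite ler_wpM2l// sqr_ge0.
  have := sqr_ge0 kp; nra.
apply: le_trans (_ : 4 * be * (3 * (kp ^+ 2 + S t ^+ 2 + Z t ^+ 2) + 1) <= _).
  have := ler_wpM2l (mulr_ge0 (ler0n _ 4) (le_trans ler01 be1)) h3; lra.
have -> : 12 * (1 + kp) ^+ 2 * be * Q t = 4 * be * (3 * (1 + kp) ^+ 2 * Q t) by ring.
by rewrite ler_wpM2l// mulr_ge0// (le_trans ler01).
Qed.

Theorem saddle_point_expectation alpha : 0 < alpha < alpha_bound C c l kp ->
  let F := potential mean_ln_tail alpha in exists a b,
  [/\ 0 < a, 0 < b,
      a = alpha * l * (mean_phi_mills a b / Num.sqrt (1 + b ^+ 2)) &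
      b ^+ 2 = alpha * mean_sqr_mills a b] /\
  [/\ forall b', 0 <= b' -> F a b <= F a b',
     forall b', 0 <= b' -> F a b' = F a b -> b' = b,
     forall a', exists2 b', 0 <= b' & F a' b' <= F a b &
     forall a', (forall b', 0 <= b' -> F a b <= F a' b') -> a' = a].
Proof.
move=> /andP[al0 al1] F.
have C_gt0 := lt_le_trans ltr01 C1; have k0 : 0 < 1 + kp by rewrite ltr_pwDl.
have C1'_gt0 : 0 < C1' by rewrite /C1' !mulr_gt0 ?exprn_gt0.
have lL : 0 < l * L by rewrite mulr_gt0.
have LL : 0 < L ^+ 2 by rewrite exprn_gt0.
have den : 0 < 64 * C1' + 16 * l * L + 16 * L ^+ 2 by lra.
have al2 : alpha * (64 * C1' + 16 * l * L + 16 * L ^+ 2) <= 1.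
  by rewrite -ler_pdivlMr// mul1r; exact: ltW al1.
have p1 := mulr_gt0 al0 C1'_gt0; have p2 := mulr_gt0 al0 lL; have p3 := mulr_gt0 al0 LL.
have q1 : alpha * C1' <= 1 / 64 by lra.
have q2 : alpha * l * L <= 1 / 16 by lra.
have q3 : Num.sqrt alpha * L <= 1 / 4.
  have q4 : alpha * L ^+ 2 <= 1 / 16 by lra.
  have h1 : Num.sqrt alpha * L \in Num.nneg by rewrite nnegrE mulr_ge0 ?sqrtr_ge0// ltW.
  have h2 : 1 / 4 \in (Num.nneg : {pred R}) by rewrite nnegrE divr_ge0.
  rewrite -(ler_pXn2r (isT : (0 < 2)%N) h1 h2) exprMn sqr_sqrtr ?(ltW al0)//.
  by apply: le_trans q4 _; lra.
have [] := @saddle_point_potential R mean_ln_tail mean_phi_mills R2 alpha l L C1'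
  al0 l_gt0 L_gt0 q1 q2 q3 mean_ln_tail_le0 mean_ln_tail_ge A1_bd R2_bd A1_lip R2_lip.
- by move=> a b; rewrite R2_sqr; exact: is_derive_mean_ln_tail_b.
- by move=> a b; rewrite R2_sqr; exact: is_derive_mean_ln_tail_a.
move=> a [b [[a0 b0 ea eb] h]]; exists a, b; split=> //; split => //.
by rewrite eb R2_sqr.
Qed.

End saddle_expectation.

(** * Back to the variables x and q *)

Section reparametrization.
Context {R : realType}.
Implicit Types a b x q : R.

Definition x_of a : R := a / Num.sqrt (1 + a ^+ 2).
Definition q_of b : R := b ^+ 2 / (1 + b ^+ 2).

Lemma one_sub_sqr_x_of a : 1 - x_of a ^+ 2 = (Num.sqrt (1 + a ^+ 2) ^+ 2)^-1.
Proof.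
rewrite /x_of expr_div_n sqrt1D_sqr; field.
by rewrite gt_eqF// ltr_pwDl// sqr_ge0.
Qed.

Lemma one_sub_q_of b : 1 - q_of b = (Num.sqrt (1 + b ^+ 2) ^+ 2)^-1.
Proof.
rewrite /q_of sqrt1D_sqr; field.
by rewrite gt_eqF// ltr_pwDl// sqr_ge0.
Qed.

Lemma sqrt_one_sub_sqr_x_of a : Num.sqrt (1 - x_of a ^+ 2) = (Num.sqrt (1 + a ^+ 2))^-1.
Proof. by rewrite one_sub_sqr_x_of -exprVn sqrtr_sqr ger0_norm// invr_ge0 sqrtr_ge0. Qed.

Lemma sqrt_one_sub_q_of b : Num.sqrt (1 - q_of b) = (Num.sqrt (1 + b ^+ 2))^-1.
Proof. by rewrite one_sub_q_of -exprVn sqrtr_sqr ger0_norm// invr_ge0 sqrtr_ge0. Qed.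

Lemma x_ofK a : x_of a / Num.sqrt (1 - x_of a ^+ 2) = a.
Proof. by rewrite sqrt_one_sub_sqr_x_of invrK /x_of divfK// sqrt1D_neq0. Qed.

Lemma q_ofK b : q_of b / (1 - q_of b) = b ^+ 2.
Proof.
rewrite one_sub_q_of invrK sqrt1D_sqr /q_of divfK//.
by rewrite gt_eqF// ltr_pwDl// sqr_ge0.
Qed.

Lemma x_of_itv a : -1 < x_of a < 1.
Proof.
have : x_of a ^+ 2 < 1.
  by rewrite -subr_gt0 one_sub_sqr_x_of invr_gt0 exprn_gt0// sqrt1D_gt0.
by move=> h; apply/andP; split; nra.
Qed.

Lemma q_of_itv b : 0 <= q_of b < 1.
Proof.
have p : 0 < 1 + b ^+ 2 by rewrite ltr_pwDl// sqr_ge0.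
apply/andP; split; first by rewrite divr_ge0 ?sqr_ge0// ltW.
by rewrite ltr_pdivrMr//; lra.
Qed.

Lemma x_of_surj x : -1 < x < 1 -> exists a, x = x_of a.
Proof.
move=> x1; have p : 0 < 1 - x ^+ 2 by nra.
exists (x / Num.sqrt (1 - x ^+ 2)).
have s0 : 0 < Num.sqrt (1 - x ^+ 2) by rewrite sqrtr_gt0.
have e : 1 + (x / Num.sqrt (1 - x ^+ 2)) ^+ 2 = ((Num.sqrt (1 - x ^+ 2))^-1) ^+ 2.
  rewrite expr_div_n exprVn sqr_sqrtr ?ltW//; field; exact: lt0r_neq0.
rewrite /x_of e sqrtr_sqr ger0_norm ?invr_ge0 ?ltW// invrK divfK//.
exact: lt0r_neq0.
Qed.

Lemma q_of_surj q : 0 <= q < 1 -> exists2 b, 0 <= b & q = q_of b.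
Proof.
move=> /andP[q0 q1]; have p : 0 < 1 - q by lra.
exists (Num.sqrt (q / (1 - q))); first exact: sqrtr_ge0.
rewrite /q_of sqr_sqrtr ?divr_ge0// ?ltW//; field.
by rewrite gt_eqF//= gt_eqF//; lra.
Qed.

End reparametrization.

Section transfer.
Context d (T : measurableType d) (R : realType) (P : probability T R).
Variables (S Z : {RV P >-> R}) (kappa alpha : R).
Implicit Types a b x q : R.

Lemma margin_x_of a b t : 0 <= b ->
  margin kappa S Z (x_of a) (q_of b) t = margin_ab kappa a b (S t) (Z t).
Proof.
move=> b0; have g0 := sqrt1D_neq0 a; have t0 := sqrt1D_neq0 b.
have x0 : 0 <= 1 - x_of a ^+ 2 by rewrite one_sub_sqr_x_of invr_ge0 sqr_ge0.
rewrite /margin !(sqrtrM _ x0) sqrt_one_sub_sqr_x_of sqrt_one_sub_q_of.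
have -> : Num.sqrt (q_of b) = b / Num.sqrt (1 + b ^+ 2).
  by rewrite /q_of -{1}sqrt1D_sqr -expr_div_n sqrtr_sqr ger0_norm// divr_ge0// sqrtr_ge0.
by rewrite /margin_ab /x_of; field; rewrite g0 t0.
Qed.

Lemma Phi_x_of a b : 0 <= b ->
  integrableR P (fun t => ln (gauss_tail (margin_ab kappa a b (S t) (Z t)))) ->
  Phi P alpha kappa S Z (x_of a) (q_of b) =
  (potential (mean_ln_tail S Z kappa) alpha a b)%:E.
Proof.
move=> b0 hi; rewrite /Phi unlock.
have -> : (\int[P]_w (ln (gauss_tail (margin kappa S Z (x_of a) (q_of b) w)))%:E)%E
    = (mean_ln_tail S Z kappa a b)%:E.
  rewrite /mean_ln_tail /Rintegral fineK; last exact: integrable_fin_num.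
  by apply: eq_integral => t _; rewrite margin_x_of.
rewrite -EFinM -!EFinD; congr EFin; rewrite /potential q_ofK.
rewrite one_sub_sqr_x_of one_sub_q_of !sqrt1D_sqr.
have pa : 0 < 1 + a ^+ 2 by rewrite ltr_pwDl// sqr_ge0.
have pb : 0 < 1 + b ^+ 2 by rewrite ltr_pwDl// sqr_ge0.
rewrite lnM ?posrE ?invr_gt0// !lnV ?posrE//.
ring.
Qed.

End transfer.

(** Every competitor x or q is the image of some a' or b' >= 0, so both the extremal values and
    uniqueness are inherited from the coordinates. *)
Lemma uniquely_achieved_reparam (R : realType) (F : R -> R -> \bar R) (f : R -> R -> R) (a b : R) :
  (forall a b, 0 <= b -> F (x_of a) (q_of b) = (f a b)%:E) -> 0 <= a -> 0 <= b ->
  (forall b', 0 <= b' -> f a b <= f a b') ->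
  (forall b', 0 <= b' -> f a b' = f a b -> b' = b) ->
  (forall a', exists2 b', 0 <= b' & f a' b' <= f a b) ->
  (forall a', (forall b', 0 <= b' -> f a b <= f a' b') -> a' = a) ->
  uniquely_achieved_at F (x_of a) (q_of b).
Proof.
move=> Ff a0 b0 hmin hb hsup ha.
have xa0 : 0 <= x_of a by rewrite divr_ge0// sqrtr_ge0.
have infE : inf_q F (x_of a) = (f a b)%:E.
  apply/eqP; rewrite eq_le; apply/andP; split.
    apply: ereal_inf_lbound; exists (q_of b); last exact: Ff.
    by rewrite /= in_itv/= q_of_itv.
  apply: le_ereal_inf_tmp => y [q]; rewrite /= in_itv/= => hq <-.
  by have [b' b'0 ->] := q_of_surj hq; rewrite Ff// lee_fin hmin.
have supE : sup_inf F = (f a b)%:E.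
  apply/eqP; rewrite eq_le; apply/andP; split; last first.
    apply: ereal_sup_ubound; exists (x_of a) => //.
    by rewrite /= in_itv/= x_of_itv.
  apply: ge_ereal_sup => y [x]; rewrite /= in_itv/= => hx <-.
  have [a' ->] := x_of_surj hx; have [b' b'0 h] := hsup a'.
  apply: le_trans (_ : (f a' b')%:E <= _)%E; last by rewrite lee_fin.
  apply: ereal_inf_lbound; exists (q_of b'); last exact: Ff.
  by rewrite /= in_itv/= q_of_itv.
split; split.
- by rewrite xa0 infE supE; have /andP[_ ->] := x_of_itv a.
- move=> x [/andP[x0 x1]]; have [|a' ->] := @x_of_surj R x; first by rewrite x1; lra.
  rewrite supE => e; congr x_of; apply/esym/ha => b' b'0.
  rewrite -lee_fin -e -Ff//; apply: ereal_inf_lbound; exists (q_of b') => //.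
  by rewrite /= in_itv/= q_of_itv.
- by rewrite q_of_itv Ff// infE.
- move=> q [hq]; have [b' b'0 ->] := q_of_surj hq.
  by rewrite infE Ff// => -[e]; congr q_of; apply/esym/hb.
Qed.

Theorem proposition3p3 (R : realType) :
  exists alpha0 : R -> R -> R,
  forall (kappa lambda : R), 0 < lambda ->
  0 < alpha0 lambda (Num.max kappa 0) /\
  forall (d : measure_display) (T : measurableType d) (P : probability T R)
    (G Y Z : {RV P >-> R}),
  has_law P G (normal_prob 0 1) ->
  has_cond_law P Y G (fun g => rademacher_prob (logistic (Num.sqrt lambda * g))) ->
  has_law P Z (normal_prob 0 1) ->
  independent_RVs P (fun w => (G w, Y w)) Z ->
  let S := fun w => Y w * G w in
  forall alpha : R, 0 < alpha < alpha0 lambda (Num.max kappa 0) ->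
  exists xs qs : R,
    uniquely_achieved_at (Phi P alpha kappa S Z) xs qs /\
    solves_saddle_system P alpha kappa lambda S Z xs qs.
Proof.
have [C C1 hC] := @inv_mills_bounds R; have [c c0 hc] := second_moment_bound R.
(* [C] and [c] depend on the real field alone, so the threshold is a function of lambda and kappa_+
   that serves every probability space. *)
exists (fun lambda k => alpha_bound C c (Num.sqrt lambda) k) => kappa lambda lambda0.
have l0 : 0 < Num.sqrt lambda by rewrite sqrtr_gt0.
split; first by apply: alpha_bound_gt0 => //; [exact: lt_le_trans C1|rewrite le_max lexx orbT].
move=> d T P G Y Z hG hY hZ hind S alpha halpha.
have mS : measurable_fun setT S by exact: measurable_funM.
pose S' : {RV P >-> R} := mfun_Sub (mem_set mS).
have dS : has_density P S' (tilted_density (Num.sqrt lambda)) := has_density_tilted hG hY.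
have dZ := has_density_normal hZ.
have SZ : independent_RVs P S' Z.
  move=> A B mA mB.
  have mm : measurable_fun setT (fun x : R * R => x.2 * x.1) by exact: measurable_funM.
  apply: (hind ((fun x : R * R => x.2 * x.1) @^-1` A) B) => //.
  by rewrite -[X in measurable X]setTI; exact: mm.
have [iS eS] := hc _ _ _ _ _ dS; have [iZ eZ] := hc _ _ _ _ _ dZ.
have hC' : mills_constant C by [].
have [a [b [[a0 b0 ea eb] [h1 h2 h3 h4]]]] :=
  saddle_point_expectation hC' c0 l0 dS dZ SZ iS iZ eS eZ halpha.
exists (x_of a), (q_of b); split.
  apply: (uniquely_achieved_reparam _ (ltW a0) (ltW b0) h1 h2 h3 h4) => a' b' b'0.
  by apply: (@Phi_x_of _ _ _ P S' Z) => //; exact: (integrable_ln_tail kappa hC' iS iZ).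
have mE t : margin kappa S Z (x_of a) (q_of b) t = margin_ab kappa a b (S' t) (Z t).
  exact: (@margin_x_of _ _ _ P S' Z _ _ _ _ (ltW b0)).
split.
  rewrite x_ofK unlock; under eq_integral do rewrite mE.
  rewrite (_ : (\int[P]_w _)%E = (mean_phi_mills S' Z (Num.sqrt lambda) kappa a b)%:E).
    rewrite -EFinM; congr EFin; rewrite {1}ea sqrtrM ?ltW// sqrt_one_sub_q_of.
    by ring.
  rewrite /mean_phi_mills /Rintegral fineK//; apply: integrable_fin_num => //.
  exact: (integrable_phiA (Num.sqrt lambda) kappa hC' iS iZ).
rewrite q_ofK unlock; under eq_integral do rewrite mE.
rewrite (_ : (\int[P]_w _)%E = (mean_sqr_mills S' Z kappa a b)%:E).
  by rewrite -EFinM eb.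
rewrite /mean_sqr_mills /Rintegral fineK//; apply: integrable_fin_num => //.
exact: (integrable_sqr_A kappa hC' iS iZ).
Qed.
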